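(* Assume (A1)–(A4), that $\boldsymbol\Sigma_K$ is positive definite, and that the critical values $\mathfrak z_1,\dots,\mathfrak z_{K-1}$ satisfy the propagation conditions (PC) with parameters $r>0$ and $\alpha\in(0,1]$ (all defined in the context). Let $\theta\in\mathbb R^p$. Then for every $k\le K$, $$\mathbb E\big|(\tilde\theta_k-\theta)^\top B_k(\tilde\theta_k-\theta)\big|^{r/2}\le C(p,r)^{1/2}(1+\delta)^{pk/4}(1-\delta)^{-3pk/4}\exp\Big\{\varphi(\delta)\frac{\Delta(k)}{2(1-\delta)}\Big\},$$ $$\mathbb E\big|(\tilde\theta_k-\hat\theta_k)^\top B_k(\tilde\theta_k-\hat\theta_k)\big|^{r/2}\le (\alpha C(p,r))^{1/2}(1+\delta)^{pk/4}(1-\delta)^{-3pk/4}\exp\Big\{\varphi(\delta)\frac{\Delta(k)}{2(1-\delta)}\Big\},$$ where $\varphi(\delta)=1$ in the case of homogeneous errors (that is, $\sigma_{0,i}=\sigma_0$ and $\sigma_i=\sigma$ for all $i$), and $\varphi(\delta)=\frac{2(1+\delta)}{(1-\delta)^2}-1$ otherwise.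
   Context: Model. Fix $x\in\mathbb R^d$, design points $X_1,\dots,X_n\in\mathbb R^d$, and $n>p$. One observes $Y=\mathbf f+\Sigma_0^{1/2}\varepsilon$, $\varepsilon\sim N(0,I_n)$, where $\mathbf f=(f(X_1),\dots,f(X_n))^\top$ for an unknown function $f$ and $\Sigma_0=\mathrm{diag}(\sigma_{0,1}^2,\dots,\sigma_{0,n}^2)$, $\sigma_{0,i}>0$, is unknown; $\mathbb E$ is the expectation under this model. $\Sigma=\mathrm{diag}(\sigma_1^2,\dots,\sigma_n^2)$, $\sigma_i>0$, is a known (possibly misspecified) covariance matrix. Estimators. Given basis functions $\psi_1,\dots,\psi_p$, put $\Psi_i=(\psi_1(X_i-x),\dots,\psi_p(X_i-x))^\top$ and let $\Psi$ be the $p\times n$ matrix with columns $\Psi_i$. For $k=1,\dots,K$ let $w_{k,i}\in[0,1]$ be weights (depending on $x$), $\mathcal W_k=\mathrm{diag}(w_{k,1},\dots,w_{k,n})$, $W_k=\Sigma^{-1/2}\mathcal W_k\Sigma^{-1/2}$, $B_k=\Psi W_k\Psi^\top$, $\tilde\theta_k=B_k^{-1}\Psi W_kY$ (the quasi maximum likelihood estimator), $\theta_k^*=B_k^{-1}\Psi W_k\mathbf f$. Assumptions. (A1) $\Psi\mathcal W_1$ has full row rank. (A2) $w_{l,i}\le w_{k,i}$ for all $i$ and $1\le l\le k\le K$. (A3) There is $\delta\in[0,1)$ with $1-\delta\le\sigma_{0,i}^2/\sigma_i^2\le1+\delta$ for all $i$. (A4) There are constants $1<u_0\le u$ with $u_0I_p\preceq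 B_{k-1}^{-1/2}B_kB_{k-1}^{-1/2}\preceq uI_p$ for $2\le k\le K$. ($A\preceq B$ means $B-A$ is nonnegative definite.) Adaptive procedure. For $l<m$ let $T_{lm}=(\tilde\theta_l-\tilde\theta_m)^\top B_l(\tilde\theta_l-\tilde\theta_m)$. Given positive critical values $\mathfrak z_1,\dots,\mathfrak z_{K-1}$, let $\hat k=\max\{k\le K: T_{lm}\le\mathfrak z_l \text{ for all } 1\le l<m\le k\}$ and $\hat\theta_k=\tilde\theta_{\min\{k,\hat k\}}$. (PC): for given $\alpha\in(0,1]$, $r>0$, $\mathbb E_{0,\Sigma}|(\tilde\theta_k-\hat\theta_k)^\top B_k(\tilde\theta_k-\hat\theta_k)|^r\le\alpha C(p,r)$ for all $k=2,\dots,K$, where $\mathbb E_{0,\Sigma}$ is the expectation when $Y\sim N(0,\Sigma)$ and $C(p,r)=\mathbb E|\chi^2_p|^r=2^r\Gamma(r+p/2)/\Gamma(p/2)$. Modeling bias. $D_l=B_l^{-1}\Psi W_l$; $\mathbf D_k$ is the $pk\times nk$ block diagonal matrix with blocks $D_1,\dots,D_k$; $J_k$ is the $k\times k$ all-ones matrix; $\boldsymbol\Sigma_k=\mathbf D_k(J_k\otimes\Sigma)\mathbf D_k^\top$. With $b(k)=((\theta_1^*-\theta)^\top,\dots,(\theta_k^*-\theta)^\top)^\top\in\mathbb R^{pk}$, put $\Delta(k)=b(k)^\top\boldsymbol\Sigma_k^{-1}b(k)$. *)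

(* Defs.v *)
From HB Require Import structures.
From mathcomp Require Import all_boot all_order all_algebra.
From mathcomp Require Import all_classical all_reals all_analysis.

Set Implicit Arguments.
Unset Strict Implicit.
Unset Printing Implicit Defensive.

Import Order.TTheory GRing.Theory Num.Theory.
Import numFieldNormedType.Exports.

Local Open Scope classical_set_scope.
Local Open Scope ring_scope.

Section matrices.
Context {R : realType}.

Definition diag {n} (s : 'I_n -> R) : 'M[R]_n := diag_mx (\row_i s i).

Definition quad {n} (A : 'M[R]_n) (v : 'cV[R]_n) : R := (v^T *m A *m v) 0 0.

Definition nonneg_def {n} (A : 'M[R]_n) : Prop :=
  A^T = A /\ forall v, 0 <= quad A v.

Definition pos_def {n} (A : 'M[R]_n) : Prop :=
  A^T = A /\ forall v, v != 0 -> 0 < quad A v.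

Definition loewner_le {n} (A B : 'M[R]_n) : Prop := nonneg_def (B - A).

(* Nonnegative definite square root; the value is 0 if A has none. *)
Definition msqrt {n} (A : 'M[R]_n) : 'M[R]_n :=
  xget 0 [set S | nonneg_def S /\ S *m S = A].

Definition invsqrt {n} (A : 'M[R]_n) : 'M[R]_n := msqrt (invmx A).

End matrices.

Section constants.
Context {R : realType}.

Definition Gamma (a : R) : R :=
  \int[lebesgue_measure]_(t in `]0, +oo[) (t `^ (a - 1) * expR (- t)).

(* The moment of order r of the chi-squared law with p degrees of freedom. *)
Definition C (p : nat) (r : R) : R :=
  2 `^ r * Gamma (r + p%:R / 2) / Gamma (p%:R / 2).

Definition homogeneous {n} (sigma0 sigma : 'I_n -> R) : Prop :=
  exists s0 s : R, forall i, sigma0 i = s0 /\ sigma i = s.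

Definition phi {n} (sigma0 sigma : 'I_n -> R) (delta : R) : R :=
  if `[< homogeneous sigma0 sigma >] then 1
  else 2 * (1 + delta) / (1 - delta) ^+ 2 - 1.

End constants.

Section gaussian.
Context {d : measure_display} {T : measurableType d} {R : realType}.
Variable P : probability T R.

Definition mutually_independent {n} (X : 'I_n -> {RV P >-> R}) : Prop :=
  forall (J : {set 'I_n}) (A : 'I_n -> set R),
    (forall i, measurable (A i)) ->
    P (\bigcap_(i in [set` J]) (X i @^-1` A i)) =
    (\prod_(i in J) P (X i @^-1` A i))%E.

Definition std_gaussian {n} (eps : 'I_n -> {RV P >-> R}) : Prop :=
  (forall i (A : set R), measurable A ->
     distribution P (eps i) A = normal_prob 0 1 A) /\
  mutually_independent eps.

(* mu + Sigma^(1/2) eps with Sigma = diag(s_1^2, .., s_n^2), s_i > 0: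
   its law is N(mu, Sigma) when eps ~ N(0, I_n). *)
Definition observation {n} (mu : 'cV[R]_n) (s : 'I_n -> R)
    (eps : 'I_n -> {RV P >-> R}) (omega : T) : 'cV[R]_n :=
  mu + diag s *m \col_i eps i omega.

End gaussian.

Definition design {R : realType} {d n p : nat} (psi : 'I_p -> 'cV[R]_d -> R)
    (X : 'I_n -> 'cV[R]_d) (x : 'cV[R]_d) : 'M[R]_(p, n) :=
  \matrix_(j, i) psi j (X i - x).

(* All families indexed by the scale (w, z, and the functions of k below) are
   1-based, as functions on nat; values outside 1, .., K are not used. *)
Section procedure.
Context {R : realType} {n p : nat}.
Variables (sigma : 'I_n -> R) (Psi : 'M[R]_(p, n)) (w : nat -> 'I_n -> R).

Definition Sigma : 'M[R]_n := diag (fun i => sigma i ^+ 2).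

(* The factors invmx (diag sigma) are Sigma^(-1/2), since sigma_i > 0. *)
Definition W (k : nat) : 'M[R]_n :=
  invmx (diag sigma) *m diag (w k) *m invmx (diag sigma).

Definition B (k : nat) : 'M[R]_p := Psi *m W k *m Psi^T.

Definition D (k : nat) : 'M[R]_(p, n) := invmx (B k) *m Psi *m W k.

(* qmle k Y is the quasi-MLE; qmle k f, at the regression vector, is its
   target theta*_k. *)
Definition qmle (k : nat) (Y : 'cV[R]_n) : 'cV[R]_p := D k *m Y.

Definition Tstat (l m : nat) (Y : 'cV[R]_n) : R :=
  quad (B l) (qmle l Y - qmle m Y).

Definition accepted (z : nat -> R) (k : nat) (Y : 'cV[R]_n) : bool :=
  [forall l : 'I_k.+1, forall m : 'I_k.+1,
    (1 <= l < m)%N ==> (Tstat l m Y <= z l)].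

Definition khat (K : nat) (z : nat -> R) (Y : 'cV[R]_n) : nat :=
  \max_(k < K.+1 | accepted z k Y) k.

Definition theta_hat (K : nat) (z : nat -> R) (k : nat) (Y : 'cV[R]_n) :
    'cV[R]_p :=
  qmle (minn k (khat K z Y)) Y.

Definition bigD (k : nat) : 'M[R]_(\sum_(i < k) p, \sum_(j < k) n) :=
  \mxblock_(i < k, j < k) (if i == j then D i.+1 else 0).

(* The Kronecker product of the k x k all-ones matrix with Sigma. *)
Definition J_tensor_Sigma (k : nat) :
    'M[R]_(\sum_(i < k) n, \sum_(j < k) n) :=
  \mxblock_(i < k, j < k) Sigma.

Definition bigSigma (k : nat) : 'M[R]_(\sum_(i < k) p) :=
  bigD k *m J_tensor_Sigma k *m (bigD k)^T.

Definition bias (f : 'cV[R]_n) (theta : 'cV[R]_p) (k : nat) :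
    'cV[R]_(\sum_(i < k) p) :=
  \mxcol_(i < k) (qmle i.+1 f - theta).

Definition Delta (f : 'cV[R]_n) (theta : 'cV[R]_p) (k : nat) : R :=
  quad (invmx (bigSigma k)) (bias f theta k).

(* The expectation under Y ~ N(0, Sigma) only depends on the law of Y, so it
   is computed on the space carrying the standard Gaussian vector eps. *)
Definition propagation {d : measure_display} {T : measurableType d}
    (P : probability T R) (eps : 'I_n -> {RV P >-> R})
    (K : nat) (z : nat -> R) (alpha r : R) : Prop :=
  forall k, (2 <= k <= K)%N ->
    ('E_P[fun omega => let Y := observation 0 sigma eps omega in
       (`|quad (B k) (qmle k Y - theta_hat K z k Y)| `^ r)%R]
     <= (alpha * C p r)%R%:E)%E.

End procedure.

(* Main.v *)
Require Import Defs.
From HB Require Import structures.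
From mathcomp Require Import all_boot all_order all_algebra.
From mathcomp Require Import all_classical all_reals all_analysis.
From mathcomp Require Import measurable_realfun.
From mathcomp Require Import ring lra.

Set Implicit Arguments.
Unset Strict Implicit.
Unset Printing Implicit Defensive.

Import Order.TTheory GRing.Theory Num.Theory.
Import numFieldNormedType.Exports.

Local Open Scope classical_set_scope.
Local Open Scope ring_scope.

(** The estimators of the first k scales, centred at theta and stacked in one
vector of dimension m = pk, form a linear image of the noise.  Write M for the
matrix stacking D_1, .., D_k.  The stacked vector is N(b, S0) under the true
model, with b the modeling bias and S0 = M Sigma_0 M^T, and N(0, S) when
Y ~ N(Psi^T theta, Sigma), with S = M Sigma M^T the matrix bigSigma k.  Both
losses are functions of this vector: the index min(k, khat) is decided by the
differences of the first k estimators.  So it suffices to know the moments of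
order r under N(0, S) and to pay for the change of measure.

Under N(0, S) the moment of the second loss is bounded by the propagation
condition.  For the first loss, W_k Sigma W_k <= W_k shows that B_k is at most
the precision matrix of the quasi-MLE, so that the loss is dominated by a
chi-squared variable with p degrees of freedom.

The price of the change of measure is Cauchy-Schwarz applied to the likelihood
ratio.  The two precision matrices satisfy
S^-1 / (1 + delta) <= S0^-1 <= S^-1 / (1 - delta), inversion being antitone, so
S0^-1 can be replaced by multiples of S^-1 everywhere: in the exponent, where
completing the square produces Delta(k) / (1 - delta), and in the normalizing
constants, where scaling the Gaussian integral of S^-1 produces the powers of
1 + delta and 1 - delta.  The exponent obtained is Delta(k) / (2 (1 - delta)),
and phi(delta) >= 1.

The Gaussian computations rest on integrals over R^n iterated coordinate by
coordinate (lebint).  An invertible linear map multiplies such an integral by a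
constant (jacobian_exists); the constant never has to be identified, because a
density has total mass one.  This gives the density of a linear image of a
standard Gaussian vector (std_gaussian_image_density).  The moments of the
chi-squared law come from the homogeneity of Lebesgue measure instead of polar
coordinates (chi_square_moment).  The change of measure is change_of_measure,
applied in gaussian_transfer. *)

(** * Affine substitutions in one-dimensional Lebesgue integrals *)

Section lebesgue_affine.
Context {R : realType}.
Local Notation mu := (@lebesgue_measure R).
Local Open Scope ereal_scope.

Lemma integral_lebesgue_translate (a : R) (h : R -> \bar R) :
  measurable_fun [set: R] h -> (forall x, 0 <= h x) ->
  \int[mu]_x h (x + a)%R = \int[mu]_x h x.
Proof.
move=> mh h0.
pose s : R -> measurableTypeR R := fun x => (x + a)%R.
have ms : measurable_fun [set: measurableTypeR R] s.
  exact: measurable_funD.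
have E := ge0_integral_pushforward ms mu measurableT mh (fun y _ => h0 y).
rewrite preimage_setT in E; rewrite -E.
apply: eq_measure_integral => /= A mA _; apply/esym.
apply: lebesgue_measure_unique => // _ [[b c]] _ <-.
rewrite /pushforward/=.
rewrite [X in _ = mu X](_ : _ = `](b - a)%R, (c - a)%R]%classic); last first.
  apply/seteqP; split => x /=; rewrite !in_itv/= /s; lra.
by rewrite !lebesgue_measure_itv/= !lte_fin ltrD2r -!EFinB opprB addrA subrK.
Qed.

Lemma integral_lebesgue_opp (h : R -> \bar R) :
  measurable_fun [set: R] h -> (forall x, 0 <= h x) ->
  \int[mu]_x h (- x)%R = \int[mu]_x h x.
Proof.
move=> mh h0.
have ms : measurable_fun [set: measurableTypeR R]
    (-%R : _ -> measurableTypeR R) by exact: measurable_funN.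
have E := ge0_integral_pushforward ms mu measurableT mh (fun y _ => h0 y).
rewrite preimage_setT in E; rewrite -E.
by apply: eq_measure_integral => /= A mA _; exact: lebesgue_measureN.
Qed.

Lemma integral_lebesgue_scale_pos (a : R) (h : R -> \bar R) : (0 < a)%R ->
  measurable_fun [set: R] h -> (forall x, 0 <= h x) ->
  a%:E * \int[mu]_x h (a * x)%R = \int[mu]_x h x.
Proof.
move=> a0 mh h0.
pose s : R -> measurableTypeR R := fun x => (a * x)%R.
have ms : measurable_fun [set: measurableTypeR R] s.
  exact: measurable_funM.
have E := ge0_integral_pushforward ms mu measurableT mh (fun y _ => h0 y).
rewrite preimage_setT in E; rewrite -[X in _ * X]E.
rewrite -[a%:E]/((NngNum (ltW a0))%:num%:E) -ge0_integral_mscale//.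
apply: eq_measure_integral => /= A mA _; apply/esym.
apply: lebesgue_measure_unique => // _ [[b c]] _ <-.
rewrite /mscale/= /pushforward/=.
rewrite [X in _ = _ * mu X](_ : _ = `](b / a)%R, (c / a)%R]%classic); last first.
  apply/seteqP; split => x /=; rewrite !in_itv/= /s.
    by rewrite ltr_pdivrMr// ler_pdivlMr// mulrC.
  by rewrite ltr_pdivrMr// ler_pdivlMr// mulrC.
rewrite !lebesgue_measure_itv/= !lte_fin ltr_pM2r ?invr_gt0//.
case: ifP => _; last by rewrite mule0.
by rewrite -EFinB -EFinM -mulrBl mulrCA divff ?gt_eqF// mulr1.
Qed.

Lemma integral_lebesgue_scale (a : R) (h : R -> \bar R) : a != 0%R ->
  measurable_fun [set: R] h -> (forall x, 0 <= h x) ->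
  `|a|%:E * \int[mu]_x h (a * x)%R = \int[mu]_x h x.
Proof.
move=> a0 mh h0; have [apos|aneg] := ltP 0%R a.
  by rewrite gtr0_norm//; exact: integral_lebesgue_scale_pos.
rewrite ler0_norm// -(integral_lebesgue_opp mh h0).
have Na0 : (0 < - a)%R by rewrite oppr_gt0 lt_neqAle a0.
have mhN : measurable_fun [set: R] (fun x => h (- x)%R).
  exact: measurableT_comp.
rewrite -(integral_lebesgue_scale_pos Na0 mhN)//.
by congr (_ * _); apply: eq_integral => x _; rewrite mulNr opprK.
Qed.

End lebesgue_affine.

(** * Iterated Lebesgue integrals over column vectors *)

Section vector_measurability.
Context {R : realType}.
Local Open Scope ereal_scope.

Definition coord_measurable d (T : measurableType d) n (f : T -> 'cV[R]_n) :=
  forall i, measurable_fun [set: T] (fun t => f t i ord0).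

(** Borel functions on R^n are described by what they do to measurable vectors:
stability under substitutions and partial integrals is then immediate, and
R^n needs no sigma-algebra of its own. *)
Definition borel n (h : 'cV[R]_n -> \bar R) :=
  forall d (T : measurableType d) (f : T -> 'cV[R]_n),
    coord_measurable f -> measurable_fun [set: T] (fun t => h (f t)).

(** Joint measurability of a family of functions on R^n, in the same style: this
is what Tonelli's theorem needs when the parameter is integrated. *)
Definition borel_in d (T : measurableType d) n (F : T -> 'cV[R]_n -> \bar R) :=
  forall d' (T' : measurableType d') (g : T' -> T) (f : T' -> 'cV[R]_n),
    measurable_fun [set: T'] g -> coord_measurable f ->
    measurable_fun [set: T'] (fun t => F (g t) (f t)).

Definition vcons n (x : R) (y : 'cV[R]_n) : 'cV[R]_n.+1 :=
  col_mx (x%:M : 'M[R]_1) y.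

Lemma vcons0 n (x : R) (y : 'cV[R]_n) : vcons x y ord0 ord0 = x.
Proof.
rewrite /vcons (_ : ord0 = lshift n (ord0 : 'I_1)); last by apply: val_inj.
by rewrite (@col_mxEu R 1 n 1) mxE eqxx mulr1n.
Qed.

Lemma vcons_lift n (x : R) (y : 'cV[R]_n) i j :
  vcons x y (lift ord0 i) j = y i j.
Proof.
rewrite /vcons (_ : lift ord0 i = rshift 1 i); last by apply: val_inj.
by rewrite (@col_mxEd R 1 n 1).
Qed.

Lemma coord_measurable_vcons d (T : measurableType d) n (g : T -> R)
    (f : T -> 'cV[R]_n) :
  measurable_fun [set: T] g -> coord_measurable f ->
  coord_measurable (fun t => vcons (g t) (f t)).
Proof.
move=> mg mf i; case: (unliftP ord0 i) => [j ->|->].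
  by under eq_fun do rewrite vcons_lift; exact: mf.
by under eq_fun do rewrite vcons0.
Qed.

Lemma coord_measurableD d (T : measurableType d) n (f g : T -> 'cV[R]_n) :
  coord_measurable f -> coord_measurable g ->
  coord_measurable (fun t => f t + g t)%R.
Proof.
by move=> mf mg i; under eq_fun do rewrite mxE; exact: measurable_funD.
Qed.

Lemma coord_measurable_cst d (T : measurableType d) n (b : 'cV[R]_n) :
  coord_measurable (fun _ : T => b).
Proof. by move=> i; exact: measurable_cst. Qed.

Lemma coord_measurableM d (T : measurableType d) m n (A : 'M[R]_(m, n))
    (f : T -> 'cV[R]_n) :
  coord_measurable f -> coord_measurable (fun t => A *m f t)%R.
Proof.
move=> mf i; under eq_fun do rewrite mxE.
apply: measurable_sum => j.
by apply: measurable_funM => //; exact: mf.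
Qed.

Lemma coord_measurableZ d (T : measurableType d) n (g : T -> R)
    (f : T -> 'cV[R]_n) :
  measurable_fun [set: T] g -> coord_measurable f ->
  coord_measurable (fun t => g t *: f t)%R.
Proof.
by move=> mg mf i; under eq_fun do rewrite mxE; exact: measurable_funM.
Qed.

Lemma borel_in_at d (T : measurableType d) n (F : T -> 'cV[R]_n -> \bar R) t :
  borel_in F -> borel (F t).
Proof. by move=> mF d' T' f mf; apply: mF. Qed.

Lemma borel_in_vcons d (T : measurableType d) n
    (F : T -> 'cV[R]_n.+1 -> \bar R) :
  borel_in F ->
  borel_in (fun (z : T * measurableTypeR R) y => F z.1 (vcons z.2 y)).
Proof.
move=> mF d' T' g f mg mf; apply: mF.
  exact: measurableT_comp measurable_fst mg.
by apply: coord_measurable_vcons => //; exact: measurableT_comp measurable_snd mg.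
Qed.

Lemma borel_vcons n (h : 'cV[R]_n.+1 -> \bar R) : borel h ->
  borel_in (fun (x : measurableTypeR R) y => h (vcons x y)).
Proof.
by move=> mh d' T' g f mg mf; apply: mh; exact: coord_measurable_vcons.
Qed.

End vector_measurability.

Section lebesgue_vector.
Context {R : realType}.
Local Notation mu := (@lebesgue_measure R).
Local Open Scope ereal_scope.

Fixpoint lebint n : ('cV[R]_n -> \bar R) -> \bar R :=
  if n is n'.+1 then fun h => \int[mu]_x lebint (fun y => h (vcons x y))
  else fun h => h 0%R.

Lemma lebint_ge0 n (h : 'cV[R]_n -> \bar R) :
  (forall y, 0 <= h y) -> 0 <= lebint h.
Proof.
elim: n h => [|n IH] h h0 /=; first exact: h0.
by apply: integral_ge0 => x _; exact: IH.
Qed.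

Lemma eq_lebint n (h h' : 'cV[R]_n -> \bar R) :
  (forall y, h y = h' y) -> lebint h = lebint h'.
Proof. by move=> hh'; congr lebint; exact/funext. Qed.

(** The induction moves the first coordinate into the parameter, so that the
measurability part of Tonelli's theorem applies to a product of two spaces. *)
Lemma measurable_lebint d (T : measurableType d) n
    (F : T -> 'cV[R]_n -> \bar R) :
  (forall t y, 0 <= F t y) -> borel_in F ->
  measurable_fun [set: T] (fun t => lebint (F t)).
Proof.
elim: n d T F => [|n IH] d T F F0 mF /=.
  apply: (mF _ _ id (fun=> 0%R)) => //; exact: coord_measurable_cst.
have mG := IH _ _ _ (fun _ _ => F0 _ _) (borel_in_vcons mF).
apply: (measurable_fun_fubini_tonelli_F (m2 := mu) _ mG) => z.
exact: lebint_ge0.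
Qed.

Lemma measurable_lebint_vcons n (h : 'cV[R]_n.+1 -> \bar R) :
  (forall y, 0 <= h y) -> borel h ->
  measurable_fun [set: measurableTypeR R] (fun x => lebint (fun y => h (vcons x y))).
Proof.
by move=> h0 mh; apply: measurable_lebint => //; exact: borel_vcons.
Qed.

Lemma le_lebint n (h h' : 'cV[R]_n -> \bar R) :
  (forall y, 0 <= h y) -> borel h -> borel h' -> (forall y, h y <= h' y) ->
  lebint h <= lebint h'.
Proof.
elim: n h h' => [|n IH] h h' h0 mh mh' hh' /=; first exact: hh'.
have h'0 y : 0 <= h' y by exact: le_trans (h0 y) (hh' y).
apply: ge0_le_integral => //.
- by move=> x _; exact: lebint_ge0.
- exact: measurable_lebint_vcons.
- exact: measurable_lebint_vcons.
move=> x _; apply: IH => //; exact: (borel_in_at x (borel_vcons _)).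
Qed.

Lemma lebintZl n (h : 'cV[R]_n -> \bar R) (c : \bar R) :
  0 <= c -> (forall y, 0 <= h y) -> borel h ->
  lebint (fun y => c * h y) = c * lebint h.
Proof.
elim: n h => [//|n IH] h c0 h0 mh /=.
rewrite -ge0_integralZl//; last 2 first.
- exact: measurable_lebint_vcons.
- by move=> x _; exact: lebint_ge0.
apply: eq_integral => x _; apply: IH => //.
exact: (borel_in_at x (borel_vcons _)).
Qed.

Lemma lebintD n (h h' : 'cV[R]_n -> \bar R) :
  (forall y, 0 <= h y) -> (forall y, 0 <= h' y) -> borel h -> borel h' ->
  lebint (fun y => h y + h' y) = lebint h + lebint h'.
Proof.
elim: n h h' => [//|n IH] h h' h0 h'0 mh mh' /=.
rewrite -ge0_integralD//; last 4 first.
- by move=> x _; exact: lebint_ge0.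
- exact: measurable_lebint_vcons.
- by move=> x _; exact: lebint_ge0.
- exact: measurable_lebint_vcons.
apply: eq_integral => x _; apply: IH => //;
  exact: (borel_in_at x (borel_vcons _)).
Qed.

Lemma lebint_tonelli d (T : measurableType d) n (F : T -> 'cV[R]_n -> \bar R)
    (nu : {sigma_finite_measure set T -> \bar R}) :
  (forall t y, 0 <= F t y) -> borel_in F ->
  \int[nu]_t lebint (F t) = lebint (fun y => \int[nu]_t F t y).
Proof.
elim: n F => [//|n IH] F F0 mF /=.
have mG := measurable_lebint (fun _ _ => F0 _ _) (borel_in_vcons mF).
rewrite (fubini_tonelli (m1 := nu) (m2 := mu) _ mG)//; last first.
  by move=> z; exact: lebint_ge0.
apply: eq_integral => x _; apply: IH => // d' T' g f mg mf.
by apply: mF => //; exact: coord_measurable_vcons.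
Qed.

Lemma lebint_translate n (h : 'cV[R]_n -> \bar R) (b : 'cV[R]_n) :
  (forall y, 0 <= h y) -> borel h ->
  lebint (fun y => h (y + b)%R) = lebint h.
Proof.
elim: n h b => [|n IH] h b h0 mh /=; first by congr h; apply/colP => -[].
pose b0 := b ord0 ord0; pose b' : 'cV[R]_n := \col_i b (lift ord0 i) ord0.
transitivity (\int[mu]_x lebint (fun y => h (vcons (x + b0)%R y))).
  apply: eq_integral => x _; rewrite -[RHS](IH _ b')//.
    apply: eq_lebint => y; congr h.
    apply/colP => i; rewrite mxE; case: (unliftP ord0 i) => [j ->|->].
      by rewrite !vcons_lift !mxE.
    by rewrite !vcons0.
  exact: (borel_in_at _ (borel_vcons _)).
apply: (integral_lebesgue_translate b0
  (h := fun x => lebint (fun y => h (vcons x y)))).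
  exact: measurable_lebint_vcons.
by move=> x; exact: lebint_ge0.
Qed.

(** Multiplying by the Jacobian, instead of dividing by it, keeps the statement
within nonnegative extended reals. *)
Lemma lebint_scale n (h : 'cV[R]_n -> \bar R) (s : R) : (0 < s)%R ->
  (forall y, 0 <= h y) -> borel h ->
  (s ^+ n)%:E * lebint (fun y => h (s *: y)%R) = lebint h.
Proof.
move=> s0; elim: n h => [|n IH] h h0 mh /=; first by rewrite expr0 mul1e scaler0.
rewrite -[RHS](integral_lebesgue_scale_pos s0); last 2 first.
- exact: measurable_lebint_vcons.
- by move=> x; exact: lebint_ge0.
have mhs : borel (fun y => h (s *: y)%R).
  by move=> d T f mf; apply: mh; exact: coord_measurableZ.
have mhs1 : measurable_fun [set: measurableTypeR R]
    (fun x => lebint (fun y => h (s *: vcons x y)%R)).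
  exact: (measurable_lebint_vcons (h := fun y => h (s *: y)%R)).
rewrite exprS EFinM -muleA; congr (_ * _).
rewrite -(ge0_integralZl mu measurableT mhs1)//; last 2 first.
- by move=> x _; exact: lebint_ge0.
- by rewrite lee_fin exprn_ge0// ltW.
apply: eq_integral => x _.
rewrite -[RHS]IH//; last exact: (borel_in_at _ (borel_vcons _)).
congr (_ * _); apply: eq_lebint => y; congr h.
apply/colP => i; rewrite mxE; case: (unliftP ord0 i) => [j ->|->].
  by rewrite !vcons_lift !mxE.
by rewrite !vcons0.
Qed.

Lemma lebint_col_mx m q (h : 'cV[R]_(m + q) -> \bar R) :
  lebint h = lebint (fun y1 => lebint (fun y2 => h (col_mx y1 y2))).
Proof.
elim: m h => [|m IH] h /=.
  apply: eq_lebint => y; congr h; apply/colP => i.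
  have {2}-> : i = rshift 0 i by apply: val_inj.
  by rewrite col_mxEd.
apply: eq_integral => x _; rewrite IH; apply: eq_lebint => y1.
apply: eq_lebint => y2; congr h; apply/colP => i.
case: (unliftP (ord0 : 'I_(m + q).+1) i) => [j Ej|->].
  rewrite Ej vcons_lift; have [k Ek|k Ek] := split_ordP j; rewrite Ek.
    have -> : lift (ord0 : 'I_(m + q).+1) (lshift q k) =
              lshift q (lift (ord0 : 'I_m.+1) k) by apply: val_inj.
    by rewrite [LHS]col_mxEu [RHS]col_mxEu vcons_lift.
  have -> : lift (ord0 : 'I_(m + q).+1) (rshift m k) =
            rshift m.+1 k by apply: val_inj.
  by rewrite [LHS]col_mxEd [RHS]col_mxEd.
have {2}-> : (ord0 : 'I_(m + q).+1) = lshift q (ord0 : 'I_m.+1) by apply: val_inj.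
by rewrite vcons0 [RHS]col_mxEu vcons0.
Qed.

End lebesgue_vector.

(** * Linear changes of variables *)

Section linear_change.
Context {R : realType}.
Local Notation mu := (@lebesgue_measure R).

(** The factor is the inverse of the absolute value of the determinant; only its
existence matters. *)
Definition jacobian n (A : 'M[R]_n) (c : R) :=
  forall h : 'cV[R]_n -> \bar R, (forall y, (0 <= h y)%E) -> borel h ->
    lebint (fun y => h (A *m y)) = (c%:E * lebint h)%E.

Lemma borel_mulmx m n (A : 'M[R]_(m, n)) (h : 'cV[R]_m -> \bar R) :
  borel h -> borel (fun y => h (A *m y)).
Proof. by move=> mh d T f mf; apply: mh; exact: coord_measurableM. Qed.

Lemma borel_translate n (b : 'cV[R]_n) (h : 'cV[R]_n -> \bar R) :
  borel h -> borel (fun y => h (y + b)).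
Proof.
move=> mh d T f mf; apply: mh.
by apply: coord_measurableD => //; exact: coord_measurable_cst.
Qed.

Lemma jacobianM n (A B : 'M[R]_n) a b :
  jacobian A a -> jacobian B b -> jacobian (A *m B) (b * a).
Proof.
move=> jA jB h h0 mh; rewrite EFinM -muleA -jA// -(jB (fun y => h (A *m y)))//.
  by apply: eq_lebint => y; rewrite mulmxA.
exact: borel_mulmx.
Qed.

Lemma mul_block_vcons n (a : R) (u : 'rV[R]_n) (v : 'cV[R]_n) (S : 'M[R]_n)
    (x : R) (y : 'cV[R]_n) :
  (block_mx a%:M u v S : 'M[R]_(1 + n)) *m vcons x y =
  vcons (a * x + (u *m y) ord0 ord0) (x *: v + S *m y).
Proof.
rewrite /vcons [LHS](@mul_block_col R 1 n 1 n 1) -scalar_mxM mul_mx_scalar.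
congr col_mx; apply/matrixP => i j.
by rewrite !ord1 !mxE eqxx mulr1n.
Qed.

(** A shear of the first coordinate: once the other coordinates are integrated
last, it is a translation of the first one. *)
Lemma jacobian_upper n (u : 'rV[R]_n) :
  jacobian (block_mx 1%:M u 0 1%:M : 'M[R]_(1 + n)) 1.
Proof.
move=> h h0 mh; rewrite mul1e /=.
have mF : borel_in (fun (x : measurableTypeR R) y => h (vcons (x + (u *m y) ord0 ord0) y)).
  move=> d' T' g f mg mf; apply: mh; apply: coord_measurable_vcons => //.
  apply: measurable_funD => //; exact: (coord_measurableM u mf ord0).
transitivity (\int[mu]_x lebint (fun y => h (vcons (x + (u *m y) ord0 ord0)%R y)))%E.
  apply: eq_integral => x _; apply: eq_lebint => y.
  by rewrite mul_block_vcons mul1r scaler0 add0r mul1mx.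
rewrite (lebint_tonelli mu _ mF)//.
rewrite (lebint_tonelli mu _ (borel_vcons mh))//.
apply: eq_lebint => y.
apply: (integral_lebesgue_translate _ (h := fun x => h (vcons x y))) => //.
apply: (borel_vcons mh (T' := measurableTypeR R) (g := id) (f := fun=> y)) => //.
Qed.

Lemma jacobian_lower n (v : 'cV[R]_n) :
  jacobian (block_mx 1%:M 0 v 1%:M : 'M[R]_(1 + n)) 1.
Proof.
move=> h h0 mh; rewrite mul1e /=; apply: eq_integral => x _.
rewrite -[RHS](lebint_translate (x *: v))//; last exact: (borel_in_at _ (borel_vcons _)).
apply: eq_lebint => y.
by rewrite mul_block_vcons mul1r mul0mx mxE addr0 mul1mx addrC.
Qed.

Lemma jacobian_diag n (a : R) (S : 'M[R]_n) c : a != 0 -> 0 <= c -> jacobian S c ->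
  jacobian (block_mx a%:M 0 0 S : 'M[R]_(1 + n)) (`|a|^-1 * c).
Proof.
move=> a0 c0 jS h h0 mh /=.
have mlh := measurable_lebint_vcons h0 mh.
rewrite -(integral_lebesgue_scale a0 mlh); last by move=> x; exact: lebint_ge0.
rewrite muleA -EFinM mulrAC mulVf ?normr_eq0// mul1r.
have mla : measurable_fun [set: measurableTypeR R]
    (fun x => lebint (fun y => h (vcons (a * x) y))).
  by apply: (measurableT_comp mlh); exact: measurable_funM.
rewrite -(ge0_integralZl mu measurableT mla)//; last first.
  by move=> x _; exact: lebint_ge0.
apply: eq_integral => x _.
have mx := borel_in_at (a * x) (borel_vcons mh).
rewrite -(jS _ (fun=> h0 _) mx); apply: eq_lebint => y.
by rewrite mul_block_vcons mul0mx mxE addr0 scaler0 add0r.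
Qed.

(** Block Gaussian elimination: a matrix with nonzero top left entry is the product
of a lower shear, a block diagonal matrix whose second block is the Schur
complement, and an upper shear.  A zero pivot is removed by adding another row
to the first one. *)
Lemma jacobian_exists n (A : 'M[R]_n) : A \in unitmx ->
  exists2 c, 0 < c & jacobian A c.
Proof.
elim: n A => [|n IH] A uA.
  by exists 1 => // h h0 mh /=; rewrite mul1e; congr h; apply/colP => -[].
wlog a0 : A uA / (A : 'M[R]_(1 + n)) ord0 ord0 != 0.
  move=> pivot.
  have [//|a0] := boolP (A ord0 ord0 != 0); first exact: pivot.
  have [i vi] : exists i, (A : 'M[R]_n.+1) (lift ord0 i) ord0 != 0.
    apply/existsP; apply: contraLR uA; rewrite negb_exists => /forallP v0.
    rewrite unitmxE (expand_det_col _ ord0) big1 ?unitr0// => i _.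
    case: (unliftP ord0 i) => [j ->|->].
      by have /negbNE/eqP -> := v0 j; rewrite mul0r.
    by move/negbNE/eqP: a0 => ->; rewrite mul0r.
  (* adding row i of the lower block to the first row makes the pivot nonzero *)
  pose t : 'rV[R]_n := delta_mx 0 i.
  pose U (s : 'rV[R]_n) : 'M[R]_n.+1 := block_mx (1%:M : 'M[R]_1) s 0 1%:M.
  have UU : U (- t) *m U t = 1%:M.
    rewrite /U [LHS](@mulmx_block R 1 n 1 n 1 n) !mul1mx !mul0mx !mulmx1 !mulmx0.
    by rewrite addr0 !add0r subrr [RHS](@scalar_mx_block R 1 n).
  have [c c0 jc] : exists2 c, 0 < c & jacobian (U t *m A) c.
    apply: pivot.
      by rewrite unitmx_mul uA andbT; have /mulmx1_unit[] := UU.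
    suff -> : (U t *m A) ord0 ord0 = A (lift ord0 i) ord0 by [].
    have Ut j : U t ord0 (lift ord0 j) = (j == i)%:R.
      rewrite /U (_ : lift ord0 j = rshift 1 j); last by apply: val_inj.
      have -> : (ord0 : 'I_n.+1) = lshift n (ord0 : 'I_1) by apply: val_inj.
      by rewrite (@block_mxEur R 1 n 1 n) mxE eqxx.
    rewrite mxE big_ord_recl (eqP (negbNE a0)) mulr0 add0r (bigD1 i)//= Ut eqxx mul1r.
    by rewrite big1 ?addr0// => j /negPf ji; rewrite Ut ji mul0r.
  exists (c * 1); first by rewrite mulr1.
  rewrite -[A]mul1mx -UU -mulmxA; apply: jacobianM => //; exact: jacobian_upper.
set a := A ord0 ord0 in a0.
pose u : 'rV[R]_n := ursubmx (A : 'M[R]_(1 + n)).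
pose v : 'cV[R]_n := dlsubmx (A : 'M[R]_(1 + n)).
pose S : 'M[R]_n := drsubmx (A : 'M[R]_(1 + n)) - a^-1 *: (v *m u).
pose L : 'M[R]_n.+1 := block_mx (1%:M : 'M[R]_1) 0 (a^-1 *: v) 1%:M.
pose D : 'M[R]_n.+1 := block_mx (a%:M : 'M[R]_1) 0 0 S.
pose U : 'M[R]_n.+1 := block_mx (1%:M : 'M[R]_1) (a^-1 *: u) 0 1%:M.
have EA : A = L *m (D *m U).
  rewrite -[LHS](@submxK R 1 n 1 n) /L /D /U.
  rewrite [X in _ *m X](@mulmx_block R 1 n 1 n 1 n) [RHS](@mulmx_block R 1 n 1 n 1 n).
  rewrite !mul1mx !mul0mx !mulmx1 !mulmx0 !addr0 !add0r.
  have -> : ulsubmx (A : 'M[R]_(1 + n)) = a%:M.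
    apply/matrixP => i j; rewrite !ord1 !mxE eqxx mulr1n /a; congr (A _ _); exact: val_inj.
  rewrite mul_scalar_mx mul_mx_scalar !scalerA mulfV// !scale1r.
  by rewrite -scalemxAl /S addrC subrK.
have uS : S \in unitmx.
  move: uA; rewrite EA !unitmx_mul => /and3P[_ + _].
  by rewrite !unitmxE [\det D](@det_ublock R 1 n) unitrM => /andP[].
have [c c0 jS] := IH S uS.
exists (1 * (`|a|^-1 * c) * 1); first by rewrite mul1r mulr1 mulr_gt0// invr_gt0 normr_gt0.
rewrite EA; apply: jacobianM; first exact: jacobian_lower.
by apply: jacobianM; [apply: jacobian_diag => //; exact: ltW|exact: jacobian_upper].
Qed.

End linear_change.

(** * The law of a standard Gaussian vector *)

Section gaussian_law.
Context {R : realType}.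
Local Notation mu := (@lebesgue_measure R).
Local Open Scope ereal_scope.

(** The density is a Radon-Nikodym derivative, unique almost everywhere, hence it
can replace the abstract derivative in the change of measure formula. *)
Lemma ge0_integral_normal_prob (m s : R) (f : R -> \bar R) :
  measurable_fun [set: R] f -> (forall x, 0 <= f x) ->
  \int[normal_prob m s]_x f x = \int[mu]_x (f x * (normal_pdf m s x)%:E).
Proof.
move=> mf f0.
have dom := normal_prob_dominates m s.
rewrite -(Radon_Nikodym_SigmaFinite.change_of_variables dom f0)//.
have mpdf : measurable_fun [set: R] (fun x => (normal_pdf m s x)%:E).
  by apply/measurable_EFinP; exact: measurable_normal_pdf.
have iRN := Radon_Nikodym_SigmaFinite.f_integrable dom.
apply: ge0_ae_eq_integral => //.
- by apply: emeasurable_funM => //; exact: measurable_int iRN.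
- exact: emeasurable_funM.
- by move=> x _; rewrite mule_ge0// Radon_Nikodym_SigmaFinite.f_ge0.
- by move=> x _; rewrite mule_ge0// lee_fin normal_pdf_ge0.
apply: ae_eqe_mul2l; apply: integral_ae_eq => //.
by move=> A _ mA; rewrite -(Radon_Nikodym_SigmaFinite.f_integral dom).
Qed.

Definition gauss_density n (y : 'cV[R]_n) : R :=
  (\prod_(i < n) normal_pdf 0 1 (y i ord0))%R.

Lemma gauss_density_ge0 n (y : 'cV[R]_n) : (0 <= gauss_density y)%R.
Proof. by apply: prodr_ge0 => i _; exact: normal_pdf_ge0. Qed.

Lemma gauss_density_vcons n (x : R) (y : 'cV[R]_n) :
  gauss_density (vcons x y) = (normal_pdf 0 1 x * gauss_density y)%R.
Proof.
rewrite /gauss_density big_ord_recl vcons0; congr (_ * _)%R.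
by apply: eq_bigr => i _; rewrite vcons_lift.
Qed.

Lemma borel_gauss_density n : borel (fun y : 'cV[R]_n => (gauss_density y)%:E).
Proof.
move=> d T f mf; apply/measurable_EFinP; apply: measurable_prod => i _.
exact: (measurableT_comp (measurable_normal_pdf 0 1) (mf i)).
Qed.

Lemma borelM n (h h' : 'cV[R]_n -> \bar R) :
  borel h -> borel h' -> borel (fun y => h y * h' y).
Proof. by move=> mh mh' d T f mf; apply: emeasurable_funM; [exact: mh|exact: mh']. Qed.

End gaussian_law.

Section independence.
Context {d : measure_display} {T : measurableType d} {R : realType}.
Variable P : probability T R.
Local Open Scope ereal_scope.

(** The product rule for the whole family: smaller families are recovered by
taking some of the sets equal to the whole line. *)
Definition box_independent n (X : 'I_n -> {RV P >-> R}) :=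
  forall A : 'I_n -> set R, (forall i, measurable (A i)) ->
    P (\bigcap_(i in [set: 'I_n]) (X i @^-1` A i)) =
    \prod_(i < n) P (X i @^-1` A i).

Lemma mutually_independent_box n (X : 'I_n -> {RV P >-> R}) :
  mutually_independent X -> box_independent X.
Proof.
move=> iX A mA; have := iX [set: 'I_n]%SET A mA.
under eq_bigl do rewrite inE.
suff -> : [set` [set: 'I_n]%SET] = [set: 'I_n] by [].
by apply/seteqP; split => i //= _; rewrite inE.
Qed.

Lemma bigcap_ordS n (F : 'I_n.+1 -> set T) :
  \bigcap_(i in [set: 'I_n.+1]) F i =
  F ord0 `&` \bigcap_(i in [set: 'I_n]) F (lift ord0 i).
Proof.
apply/seteqP; split => t /=.
  by move=> Ft; split => [|i _]; exact: Ft.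
by move=> [F0 FS] i _; case: (unliftP ord0 i) => [j ->|->//]; exact: FS.
Qed.

Definition cylinder m (Z : 'I_m -> {RV P >-> R}) : set (set T) :=
  [set C | exists2 B : 'I_m -> set R, (forall i, measurable (B i)) &
           C = \bigcap_(i in [set: 'I_m]) (Z i @^-1` B i)].

Lemma measurable_RV_preimage (X : {RV P >-> R}) (A : set R) :
  measurable A -> measurable (X @^-1` A).
Proof. by move=> mA; rewrite -[_ @^-1` _]setTI; exact: measurable_funPT. Qed.

Lemma measurable_cylinder m (Z : 'I_m -> {RV P >-> R}) :
  cylinder Z `<=` measurable.
Proof.
move=> _ [B mB ->]; apply: fin_bigcap_measurable; first exact: finite_finset.
by move=> i _; exact: measurable_RV_preimage.
Qed.

Lemma setI_closed_cylinder m (Z : 'I_m -> {RV P >-> R}) :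
  setI_closed (cylinder Z).
Proof.
move=> _ _ [B mB ->] [B' mB' ->]; exists (fun i => B i `&` B' i).
  by move=> i; exact: measurableI.
by rewrite -bigcapI.
Qed.

Lemma setT_cylinder m (Z : 'I_m -> {RV P >-> R}) : cylinder Z setT.
Proof.
by exists (fun=> setT) => //; rewrite bigcapT.
Qed.

Lemma box_independent_tail n (X : 'I_n.+1 -> {RV P >-> R}) :
  box_independent X -> box_independent (fun i => X (lift ord0 i)).
Proof.
move=> iX A mA.
have mA' i : measurable (oapp A setT (unlift ord0 i)).
  by case: (unliftP ord0 i) => [j _|_]/=.
have EA i : oapp A setT (unlift ord0 (lift ord0 i)) = A i by rewrite liftK.
have := iX _ mA'.
rewrite bigcap_ordS big_ord_recl unlift_none/= preimage_setT setTI.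
rewrite probability_setT mul1e.
by under eq_bigcapr do rewrite EA; under eq_bigr do rewrite EA.
Qed.

Lemma box_independent_cylinder n (X : 'I_n.+1 -> {RV P >-> R}) (A : set R) C :
  box_independent X -> measurable A ->
  cylinder (fun i => X (lift ord0 i)) C ->
  P (X ord0 @^-1` A `&` C) = P (X ord0 @^-1` A) * P C.
Proof.
move=> iX mA [B mB ->].
have mB' i : measurable (oapp B A (unlift ord0 i)).
  by case: (unliftP ord0 i) => [j _|_]/=.
have EB i : oapp B A (unlift ord0 (lift ord0 i)) = B i by rewrite liftK.
have := iX _ mB'.
rewrite bigcap_ordS big_ord_recl unlift_none/= (box_independent_tail iX mB).
by under eq_bigcapr do rewrite EB; under eq_bigr do rewrite EB.
Qed.

(** For A fixed, both sides are finite measures in E which agree on the cylinders,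
a family closed under intersection that generates the sigma-algebra. *)
Lemma box_independent_sigma n (X : 'I_n.+1 -> {RV P >-> R}) (A : set R) E :
  box_independent X -> measurable A ->
  <<s cylinder (fun i => X (lift ord0 i)) >> E ->
  P (X ord0 @^-1` A `&` E) = P (X ord0 @^-1` A) * P E.
Proof.
move=> iX mA sE; set G := cylinder _ in sE.
have mXA := measurable_RV_preimage (X ord0) mA.
have PA : P (X ord0 @^-1` A) \is a fin_num by exact: fin_num_measure.
have PA0 : (0 <= fine (P (X ord0 @^-1` A)))%R by exact: fine_ge0.
suff U : mrestr P mXA E = mscale (NngNum PA0) P E.
  by move: U; rewrite /mrestr /mscale/= fineK// setIC.
apply: (g_sigma_algebra_measure_unique G (@measurable_cylinder _ _)
  (fun=> setT) (fun=> setT_cylinder _)) sE.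
- exact: (bigcup_const _ (ex_intro _ 0%N Logic.I)).
- exact: setI_closed_cylinder.
- move=> C GC; rewrite /= /mrestr /mscale/= fineK// setIC.
  exact: box_independent_cylinder.
- by move=> _; rewrite /= /mrestr ltey_eq fin_num_measure//; exact: measurableI.
Qed.

(** The pair formed by the first variable and the sample point, the latter seen
through the sigma-algebra of the other variables, has a product law; Tonelli's
theorem then integrates out the first variable. *)
Lemma integral_box_independent n (X : 'I_n.+1 -> {RV P >-> R})
    (F : R -> 'cV[R]_n -> \bar R) :
  box_independent X -> (forall x y, 0 <= F x y) -> borel_in F ->
  \int[P]_t F (X ord0 t) (\col_i X (lift ord0 i) t) =
  \int[distribution P (X ord0)]_x
    \int[P]_t F x (\col_i X (lift ord0 i) t).
Proof.
move=> iX F0 mF.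
pose Z (i : 'I_n) := X (lift ord0 i).
pose T' := g_sigma_algebraType (cylinder Z).
have subG : <<s cylinder Z >> `<=` @measurable _ T.
  by apply: smallest_sub; [exact: sigma_algebra_measurable|exact: measurable_cylinder].
have mid : measurable_fun [set: T] (id : T -> T').
  by move=> _ A mA; rewrite setTI; exact: subG.
pose idm : {mfun T >-> T'} := HB.pack (id : T -> T')
  (isMeasurableFun.Build _ _ _ _ (id : T -> T') mid).
have mZ i : measurable_fun [set: T'] (Z i : T' -> R).
  move=> _ A mA; rewrite setTI; apply: sub_sigma_algebra.
  exists (fun j => if j == i then A else setT); first by move=> j; case: ifP.
  apply/seteqP; split => t /=.
    by move=> At j _ /=; case: eqP => // ->.
  by move=> /(_ i Logic.I)/=; rewrite eqxx.
pose Zv (t : T') : 'cV[R]_n := \col_i Z i t.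
have mZv : coord_measurable Zv.
  by move=> i; under eq_fun do rewrite mxE; exact: mZ.
pose phi (t : T) : R * T' := (X ord0 t, t).
have mphi : measurable_fun [set: T] phi.
  by apply: measurable_fun_pair => //; exact: mid.
pose G (z : R * T') := F z.1 (Zv z.2).
have mG : measurable_fun [set: R * T'] G.
  apply: mF; first exact: measurable_fst.
  by move=> i; exact: measurableT_comp (mZv i) measurable_snd.
transitivity (\int[pushforward P phi]_z G z).
  rewrite ge0_integral_pushforward// ?preimage_setT//.
  by move=> z _; exact: F0.
transitivity (\int[distribution P (X ord0) \x distribution P idm]_z G z).
  apply: eq_measure_integral => C mC _; apply/esym.
  apply: product_measure_unique => // A B mA mB.
  rewrite /= /distribution /pushforward/=.
  rewrite -(box_independent_sigma iX mA mB).
  by congr (P _); apply/seteqP; split.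
rewrite fubini_tonelli1//.
apply: eq_integral => x _; rewrite /fubini_F.
rewrite ge0_integral_pushforward// ?preimage_setT//.
- exact: (borel_in_at x mF mZv).
- by move=> y _; exact: F0.
- by move=> z; exact: F0.
Qed.

Lemma integral_law (X : {RV P >-> R})
    (m : {measure set (measurableTypeR R) -> \bar R}) (f : R -> \bar R) :
  (forall A, measurable A -> distribution P X A = m A) ->
  measurable_fun [set: R] f -> (forall x, 0 <= f x) ->
  \int[P]_t f (X t) = \int[m]_x f x.
Proof.
move=> lawX mf f0.
have mX : measurable_fun [set: T] (X : T -> measurableTypeR R).
  exact: (@measurable_funPT _ _ _ _ X).
have E := ge0_integral_pushforward mX P measurableT mf (fun y _ => f0 y).
rewrite preimage_setT in E; rewrite -E.
by apply: eq_measure_integral => A mA _; exact: lawX.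
Qed.

(** Induction on the dimension, integrating out the first coordinate. *)
Theorem integral_gaussian_vector n (X : 'I_n -> {RV P >-> R})
    (h : 'cV[R]_n -> \bar R) :
  box_independent X ->
  (forall i A, measurable A -> distribution P (X i) A = normal_prob 0 1 A) ->
  (forall y, 0 <= h y) -> borel h ->
  \int[P]_t h (\col_i X i t) = lebint (fun y => h y * (gauss_density y)%:E).
Proof.
elim: n X h => [|n IH] X h iX lawX h0 mh.
  rewrite /= /gauss_density big_ord0 mule1.
  transitivity (\int[P]_t cst (h 0%R) t).
    by apply: eq_integral => t _; congr h; apply/colP => -[].
  by rewrite integral_cst// -[RHS]mule1; congr (_ * _); exact: probability_setT.
have mF : borel_in (fun (x : R) y => h (vcons x y)).
  by move=> d' T' g f mg mf; apply: mh; exact: coord_measurable_vcons.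
transitivity (\int[P]_t h (vcons (X ord0 t) (\col_i X (lift ord0 i) t))).
  apply: eq_integral => t _; congr h; apply/colP => i; rewrite mxE.
  case: (unliftP ord0 i) => [j ->|->]; first by rewrite vcons_lift mxE.
  by rewrite vcons0.
rewrite (integral_box_independent iX _ mF)//.
have iXS := box_independent_tail iX.
under eq_integral => x _.
  rewrite (IH _ (fun y => h (vcons x y)) iXS)//; last 2 first.
  - by move=> i A mA; exact: lawX.
  - exact: borel_in_at mF.
  over.
have mG : borel_in (fun (x : R) y => h (vcons x y) * (gauss_density y)%:E).
  move=> d' T' g f mg mf; apply: emeasurable_funM; first exact: mF.
  exact: borel_gauss_density.
have mL := measurable_lebint (fun x y => mule_ge0 (h0 (vcons x y))
  (gauss_density_ge0 y : 0 <= (gauss_density y)%:E)) mG.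
rewrite /=; transitivity (\int[normal_prob 0 1]_x
    lebint (fun y => h (vcons x y) * (gauss_density y)%:E)).
  rewrite ge0_integral_distribution//; last first.
    by move=> x; apply: lebint_ge0 => y; rewrite mule_ge0// lee_fin gauss_density_ge0.
  apply: (integral_law (f := fun x =>
    lebint (fun y => h (vcons x y) * (gauss_density y)%:E))) => //.
    by move=> A; exact: lawX.
  by move=> x; apply: lebint_ge0 => y; rewrite mule_ge0// lee_fin gauss_density_ge0.
rewrite ge0_integral_normal_prob//; last first.
  by move=> x; apply: lebint_ge0 => y; rewrite mule_ge0// lee_fin gauss_density_ge0.
apply: eq_integral => x _; rewrite muleC -lebintZl//.
- apply: eq_lebint => y; rewrite gauss_density_vcons EFinM muleCA; congr (_ * _).
- by rewrite lee_fin normal_pdf_ge0.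
- by move=> y; rewrite mule_ge0// lee_fin gauss_density_ge0.
- exact: borel_in_at mG.
Qed.

End independence.

(** * Density of a linear image of a standard Gaussian vector *)

Section quadratic_forms.
Context {R : realType}.

Lemma quadE n (A : 'M[R]_n) (v : 'cV[R]_n) :
  quad A v = \sum_i v i ord0 * (A *m v) i ord0.
Proof.
by rewrite /quad -mulmxA mxE; apply: eq_bigr => i _; rewrite mxE.
Qed.

Lemma measurable_quad d (T : measurableType d) n (A : 'M[R]_n)
    (f : T -> 'cV[R]_n) :
  coord_measurable f -> measurable_fun [set: T] (fun t => quad A (f t)).
Proof.
move=> mf; under eq_fun do rewrite quadE.
apply: measurable_sum => i; apply: measurable_funM; first exact: mf.
exact: coord_measurableM.
Qed.

Lemma quad_mulmx m n (A : 'M[R]_m) (L : 'M[R]_(m, n)) (v : 'cV[R]_n) :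
  quad A (L *m v) = quad (L^T *m A *m L) v.
Proof. by rewrite /quad trmx_mul !mulmxA. Qed.

Lemma quad1_ge0 n (v : 'cV[R]_n) : 0 <= quad 1%:M v.
Proof. by rewrite quadE sumr_ge0// => i _; rewrite mul1mx -expr2 sqr_ge0. Qed.

Lemma quad1_eq0 n (v : 'cV[R]_n) : quad 1%:M v = 0 -> v = 0.
Proof.
rewrite quadE => /eqP; rewrite psumr_eq0; last first.
  by move=> i _; rewrite mul1mx -expr2 sqr_ge0.
move=> /allP v0; apply/colP => i; rewrite mxE; apply/eqP.
by have := v0 i (mem_index_enum i); rewrite mul1mx mulf_eq0 orbb.
Qed.

Lemma mulmx_tr_eq0 m n (A : 'M[R]_(m, n)) : A *m A^T = 0 -> A = 0.
Proof.
move=> AA; apply/row_matrixP => i; rewrite row0; apply: trmx_inj; rewrite trmx0.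
apply: quad1_eq0; rewrite /quad trmxK mulmx1 tr_row.
have := congr1 (fun B : 'M[R]_m => B i i) AA; rewrite !mxE => {2}<-.
by apply: eq_bigr => j _; rewrite !mxE.
Qed.

Lemma gram_unit m n (M : 'M[R]_(m, n)) : row_free M -> M *m M^T \in unitmx.
Proof.
move=> fM; rewrite -row_free_unit -kermx_eq0.
set K := kermx _; have KM : K *m M = 0.
  apply: mulmx_tr_eq0; rewrite trmx_mul -mulmxA [M *m _]mulmxA.
  by rewrite mulmxA mulmx_ker mul0mx.
by apply/eqP; apply: (row_free_inj fM); rewrite mul0mx.
Qed.

Lemma kernel_complement m n (M : 'M[R]_(m, n)) : row_free M ->
  exists q (V : 'M[R]_(q, n)), [/\ (m + q)%N = n, row_free V & M *m V^T = 0].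
Proof.
move=> fM; pose N := kermx M^T.
have rN : (m + \rank N)%N = n.
  rewrite mxrank_ker mxrank_tr (eqP fM) subnKC//.
  by rewrite -{1}(eqP fM) rank_leq_col.
exists (\rank N), (row_base N); split => //.
  exact: row_base_free.
apply: trmx_inj; rewrite trmx_mul trmxK trmx0; apply/sub_kermxP.
by rewrite eq_row_base.
Qed.

End quadratic_forms.

Section gaussian_density.
Context {R : realType}.

Lemma gauss_densityE n (y : 'cV[R]_n) :
  gauss_density y = normal_peak 1 ^+ n * expR (- quad 1%:M y / 2).
Proof.
rewrite quadE /gauss_density.
under eq_bigr => i _ do rewrite normal_pdfE// /normal_fun.
rewrite big_split/= prodr_const card_ord; congr (_ * _).
rewrite -expR_sum; congr expR; rewrite mulNr big_distrl/= -sumrN.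
apply: eq_bigr => i _; rewrite mul1mx subr0 expr1n expr2; lra.
Qed.

Lemma borel_expR_quad n (A : 'M[R]_n) :
  borel (fun y => (expR (- quad A y / 2))%:E).
Proof.
move=> d T f mf; apply/measurable_EFinP.
apply: measurableT_comp => //; apply: measurable_funM => //.
by apply: measurable_funN; exact: measurable_quad.
Qed.

Lemma expR_quad_ge0 n (A : 'M[R]_n) (y : 'cV[R]_n) :
  (0 <= (expR (- quad A y / 2))%:E)%E.
Proof. by rewrite lee_fin expR_ge0. Qed.

(** In the coordinates (y1, y2) given by x = M^T S^-1 y1 + V^T y2 one has M x = y1,
and the squared norm of x splits into a function of y1 and a function of y2
because the rows of V are orthogonal to those of M.  Integrating y2 out leaves
an unspecified factor that does not depend on h. *)
Lemma lebint_gauss_marginal m q (M : 'M[R]_(m, m + q)) (V : 'M[R]_(q, m + q))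
    (S := M *m M^T) :
  row_free M -> row_free V -> M *m V^T = 0 ->
  exists2 C : \bar R, (0 <= C)%E &
  forall h : 'cV[R]_m -> \bar R, (forall y, (0 <= h y)%E) -> borel h ->
  lebint (fun x => h (M *m x)%R * (gauss_density x)%:E)%E =
  (C * lebint (fun y => h y * (expR (- quad (invmx S) y / 2))%:E))%E.
Proof.
move=> fM fV MV0.
have uS : S \in unitmx by exact: gram_unit.
have ST : S^T = S by rewrite /S trmx_mul trmxK.
have VM0 : V *m M^T = 0 by rewrite -[V]trmxK -trmx_mul MV0 trmx0.
pose G := V *m V^T; have uG : G \in unitmx by exact: gram_unit.
pose A : 'M[R]_(m + q) := row_mx (M^T *m invmx S) V^T.
have uA : A \in unitmx.
  (* the left inverse recovers y1 as M x and y2 as (V V^T)^-1 V x *)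
  suff : col_mx M (invmx G *m V) *m A = 1%:M by case/mulmx1_unit.
  rewrite mul_col_row !mulmxA MV0 -[invmx G *m V *m M^T]mulmxA VM0 mulmx0 mul0mx.
  by rewrite mulmxV// -[invmx G *m V *m _]mulmxA mulVmx// -scalar_mx_block.
have [c c0 jA] := jacobian_exists uA.
have MA y1 y2 : M *m (A *m col_mx y1 y2) = y1.
  by rewrite mul_row_col mulmxDr !mulmxA MV0 mul0mx addr0 mulmxV// mul1mx.
have qA y1 y2 : quad 1%:M (A *m col_mx y1 y2) =
    quad (invmx S) y1 + quad 1%:M (V^T *m y2).
  rewrite mul_row_col; set a := _ *m y1; set b := _ *m y2.
  have ab : a^T *m b = 0.
    by rewrite /a /b !trmx_mul trmxK -!mulmxA [M *m (_ *m _)]mulmxA MV0 mul0mx !mulmx0.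
  have ba : b^T *m a = 0 by apply: trmx_inj; rewrite trmx_mul trmxK ab trmx0.
  have aa : a^T *m a = y1^T *m invmx S *m y1.
    rewrite /a !trmx_mul trmxK trmx_inv ST !mulmxA -[_ *m M *m M^T]mulmxA.
    by rewrite -[_ *m invmx S *m S]mulmxA mulVmx// mulmx1.
  have tD : (a + b)^T = a^T + b^T by exact: linearD.
  rewrite /quad !mulmx1 tD mulmxDl !mulmxDr ab ba aa addr0 add0r.
  by rewrite mxE.
pose k := normal_peak (1 : R) ^+ (m + q).
have k0 : 0 <= k by rewrite exprn_ge0// normal_peak_ge0.
pose g (y : 'cV[R]_q) : \bar R := (expR (- quad (V *m V^T) y / 2))%:E.
have g0 y : (0 <= g y)%E by exact: expR_quad_ge0.
have mg : borel g by exact: borel_expR_quad.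
exists ((c^-1 * k)%:E * lebint g)%E.
  by rewrite mule_ge0 ?lebint_ge0// lee_fin mulr_ge0// invr_ge0 ltW.
move=> h h0 mh.
pose F x := (h (M *m x)%R * (gauss_density x)%:E)%E.
have F0 x : (0 <= F x)%E by rewrite mule_ge0// lee_fin gauss_density_ge0.
have mF : borel F.
  by apply: borelM; [exact: borel_mulmx|exact: borel_gauss_density].
have -> : lebint F = (c^-1%:E * lebint (fun y => F (A *m y)))%E.
  by rewrite jA// muleA -EFinM mulVf ?mul1e// gt_eqF.
rewrite EFinM -!muleA; congr (_ * _)%E; rewrite lebint_col_mx.
pose w y1 : \bar R := (h y1 * (expR (- quad (invmx S) y1 / 2))%:E)%E.
have w0 y : (0 <= w y)%E by rewrite mule_ge0// expR_quad_ge0.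
have mw : borel w by apply: borelM => //; exact: borel_expR_quad.
have Fw y1 y2 : F (A *m col_mx y1 y2) = (k%:E * w y1 * g y2)%E.
  rewrite /F MA gauss_densityE qA opprD mulrDl expRD quad_mulmx trmxK mulmx1.
  by rewrite !EFinM !muleA [(h y1 * _)%E]muleC.
under eq_lebint => y1.
  under eq_lebint do rewrite Fw.
  rewrite lebintZl//; last by rewrite mule_ge0.
  rewrite muleC muleA; over.
rewrite lebintZl//; last by rewrite mule_ge0// lebint_ge0.
by rewrite [(lebint g * _)%E]muleC -!muleA.
Qed.

End gaussian_density.

Section gaussian_image.
Context {d : measure_display} {T : measurableType d} {R : realType}.
Variable P : probability T R.

(** The case h = 1 fixes the normalizing constant: it is the inverse of the
Gaussian integral of Q, without any determinant. *)
Lemma std_gaussian_image_density m n (M : 'M[R]_(m, n))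
    (eps : 'I_n -> {RV P >-> R}) (Q := invmx (M *m M^T)) :
  std_gaussian eps -> row_free M ->
  exists c, [/\ 0 < c,
    lebint (fun y => (expR (- quad Q y / 2))%:E) = (c^-1)%:E &
    forall h : 'cV[R]_m -> \bar R, (forall y, (0 <= h y)%E) -> borel h ->
    (\int[P]_t h (M *m \col_i eps i t)%R)%E =
    (c%:E * lebint (fun y => h y * (expR (- quad Q y / 2))%:E))%E].
Proof.
move=> [law /mutually_independent_box ind] fM.
have [q [V [mqn fV MV0]]] := kernel_complement fM.
subst n; have [C C0 HC] := lebint_gauss_marginal fM fV MV0.
have H h : (forall y, (0 <= h y)%E) -> borel h ->
    (\int[P]_t h (M *m \col_i eps i t)%R)%E =
    (C * lebint (fun y => h y * (expR (- quad Q y / 2))%:E))%E.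
  move=> h0 mh; rewrite -HC//.
  by rewrite (integral_gaussian_vector (h := fun x => h (M *m x)) ind law)//; exact: borel_mulmx.
have : (1 = C * lebint (fun y => (expR (- quad Q y / 2))%:E))%E.
  have := H (fun=> 1%E) (fun=> lee01) (fun _ _ _ _ => measurable_cst _).
  under eq_lebint do rewrite mul1e.
  by move=> <-; rewrite integral_cst// mul1e; exact/esym/probability_setT.
set L := lebint _ => CL.
have L0 : (0 <= L)%E by apply: lebint_ge0 => y; exact: expR_quad_ge0.
clearbody L.
have [C1 L1] : (C \is a fin_num) /\ (L \is a fin_num).
  have Cn0 : C != 0%E by apply/eqP => C_0; move: CL; rewrite C_0 mul0e => -[] /eqP; rewrite oner_eq0.
  have Ln0 : L != 0%E by apply/eqP => L_0; move: CL; rewrite L_0 mule0 => -[] /eqP; rewrite oner_eq0.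
  have Cp : (0 < C)%E by rewrite lt_neqAle eq_sym Cn0.
  have Lp : (0 < L)%E by rewrite lt_neqAle eq_sym Ln0.
  split; rewrite ge0_fin_numE// ltey; apply/eqP => E; move: CL; rewrite E.
    by rewrite gt0_mulye.
  by rewrite gt0_muley.
rewrite -(fineK C1) -(fineK L1) -EFinM in CL; case: CL => CL.
have Cn0 : fine C != 0.
  by apply/eqP => C_0; move: CL; rewrite C_0 mul0r => /eqP; rewrite oner_eq0.
exists (fine C); split.
- by rewrite lt_neqAle eq_sym Cn0 fine_ge0.
- by rewrite -(fineK L1); congr (_%:E); apply: (mulfI Cn0); rewrite -CL mulfV.
- by rewrite fineK.
Qed.

End gaussian_image.

(** * Change of measure between Gaussian laws *)

Section loewner_order.
Context {R : realType}.

Lemma quadZ n (A : 'M[R]_n) (a : R) (v : 'cV[R]_n) :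
  quad A (a *: v) = a ^+ 2 * quad A v.
Proof.
have tZ : (a *: v)^T = a *: v^T by exact: linearZ.
by rewrite /quad tZ -!scalemxAl -scalemxAr scalerA mxE expr2.
Qed.

Lemma quad_scale n (A : 'M[R]_n) (a : R) (v : 'cV[R]_n) :
  quad (a *: A) v = a * quad A v.
Proof. by rewrite /quad -scalemxAr -scalemxAl mxE. Qed.

Lemma quadB n (A : 'M[R]_n) (u v : 'cV[R]_n) : A^T = A ->
  quad A (u - v) = quad A u - 2 * (u^T *m A *m v) ord0 ord0 + quad A v.
Proof.
move=> AT; have tB : (u - v)^T = u^T - v^T by exact: linearB.
have vu : (v^T *m A *m u) ord0 ord0 = (u^T *m A *m v) ord0 ord0.
  have -> : v^T *m A *m u = (u^T *m A *m v)^T.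
    by rewrite !trmx_mul trmxK AT mulmxA.
  by rewrite mxE.
rewrite /quad tB !mulmxBl !mulmxBr.
move: vu; set a := v^T *m A *m u; set c := u^T *m A *m v => vu.
have subE (M N : 'M[R]_1) : (M - N) 0 0 = M 0 0 - N 0 0 by rewrite !mxE.
rewrite !subE vu.
ring.
Qed.

(** The inverse form is a Legendre transform: quad A^-1 v is the maximum over u of
2 u^T v - quad A u, which decreases when A increases.  The proof evaluates
it at the maximizer u = B^-1 v of the other form. *)
Lemma quad_invmx_antitone n (A B : 'M[R]_n) :
  A \in unitmx -> B \in unitmx -> A^T = A -> B^T = B ->
  (forall u, 0 <= quad A u) -> (forall u, quad A u <= quad B u) ->
  forall v, quad (invmx B) v <= quad (invmx A) v.
Proof.
move=> uA uB AT BT A0 AB v.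
pose u := invmx B *m v.
have Eu : quad B u = quad (invmx B) v.
  by rewrite /u quad_mulmx trmx_inv BT mulVmx// mul1mx.
have Ev : quad A (invmx A *m v) = quad (invmx A) v.
  by rewrite quad_mulmx trmx_inv AT mulVmx// mul1mx.
have := A0 (u - invmx A *m v); rewrite quadB// Ev.
have -> : (u^T *m A *m (invmx A *m v)) ord0 ord0 = quad (invmx B) v.
  rewrite -mulmxA [A *m _]mulmxA mulmxV// mul1mx /u trmx_mul trmx_inv BT.
  by [].
have := AB u; rewrite Eu; lra.
Qed.

End loewner_order.

Section change_of_measure.
Context {R : realType}.

Lemma lebint_expR_scale m (Q : 'M[R]_m) (a : R) : 0 < a ->
  lebint (fun y => (expR (- (a * quad Q y) / 2))%:E) =
  ((a `^ (- (m%:R / 2)))%:E * lebint (fun y => (expR (- quad Q y / 2))%:E))%E.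
Proof.
move=> a0; have s0 : 0 < a `^ (1 / 2) by exact: powR_gt0.
rewrite -(lebint_scale s0 (expR_quad_ge0 Q) (@borel_expR_quad _ _ Q)).
rewrite muleA -EFinM -powR_mulrn ?ltW// -powRrM -powRD; last first.
  by apply/implyP => _; rewrite gt_eqF.
rewrite (_ : _ + _ = 0) ?powRr0 ?mul1e; last by ring.
apply: eq_lebint => y; rewrite quadZ.
by rewrite -powR_mulrn ?ltW// -powRrM div1r mulVf// powRr1 ?ltW.
Qed.

(** Cauchy-Schwarz for h against the likelihood ratio, in the form of the
inequality x y <= (s^2 x^2 + s^-2 y^2) / 2 with an optimal s, which only needs
the linearity of the integral.  The square of the likelihood ratio is
proportional to the exponential of quad Q y / 2 - quad Q0 (y - b).  Replacing
Q0 by Q / (1 + delta) there and completing the square leaves a Gaussian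
integral of kap Q, with kap = (1 - delta) / (1 + delta), and the factor
exp (quad Q b / (1 - delta)).  The bound Q0 <= Q / (1 - delta) compares the
normalizing constants c0 and c. *)
Lemma change_of_measure m (Q Q0 : 'M[R]_m) (c c0 a delta : R)
    (h : 'cV[R]_m -> R) (b : 'cV[R]_m) :
  Q^T = Q -> 0 <= delta < 1 -> 0 < a -> 0 < c -> 0 < c0 ->
  (forall y, quad Q y / (1 + delta) <= quad Q0 y) ->
  (forall y, quad Q0 y <= quad Q y / (1 - delta)) ->
  lebint (fun y => (expR (- quad Q y / 2))%:E) = (c^-1)%:E ->
  lebint (fun y => (expR (- quad Q0 y / 2))%:E) = (c0^-1)%:E ->
  (forall y, 0 <= h y) -> borel (fun y => (h y)%:E) ->
  (c%:E * lebint (fun y => (h y ^+ 2)%:E * (expR (- quad Q y / 2))%:E) <= a%:E)%E ->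
  (c0%:E * lebint (fun y => (h (y + b))%:E * (expR (- quad Q0 y / 2))%:E) <=
   (a `^ (1 / 2) * ((1 + delta) `^ (m%:R / 4) *
     (1 - delta) `^ (- (3 * m%:R / 4)) *
     expR (quad Q b / (2 * (1 - delta)))))%:E)%E.
Proof.
move=> QT /andP[d0 d1] a0 cp c0p lowQ upQ gQ gQ0 h0 mh ha.
have m1 : 0 < 1 - delta by lra.
have p1 : 0 < 1 + delta by lra.
pose kap := (1 - delta) / (1 + delta).
have kap0 : 0 < kap by rewrite divr_gt0.
pose E := expR (quad Q b / (1 - delta)) * kap `^ (- (m%:R / 2)).
have E0 : 0 < E by rewrite mulr_gt0 ?expR_gt0 ?powR_gt0.
(* s balances the two terms of the inequality: s^2 a = s^-2 E *)
pose s := (E / a) `^ (1 / 4).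
have s0 : 0 < s by rewrite powR_gt0// divr_gt0.
have kapE : kap = (1 - delta) / (1 + delta) by [].
have shift : (lebint (fun y => (h (y + b))%:E * (expR (- quad Q0 y / 2))%:E) =
    lebint (fun y => (h y)%:E * (expR (- quad Q0 (y - b) / 2))%:E))%E.
  rewrite -[RHS](lebint_translate b).
  - by apply: eq_lebint => y; rewrite addrK.
  - by move=> y; rewrite -EFinM lee_fin mulr_ge0 ?expR_ge0.
  - apply: borelM => //.
    exact: (@borel_translate _ _ (- b) _ (@borel_expR_quad _ _ Q0)).
rewrite shift.
have mh2 : borel (fun y => (h y ^+ 2)%:E).
  move=> d T f mf; apply/measurable_EFinP; apply: measurable_funX.
  by apply/measurable_EFinP; exact: mh.
(* mu is the centre of the completed square *)
pose mu : 'cV[R]_m := (2 / (1 - delta)) *: b.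
pose bound y := ((s ^+ 2 / 2)%:E * ((h y ^+ 2)%:E * (expR (- quad Q y / 2))%:E) +
  (s ^- 2 / 2 * expR (quad Q b / (1 - delta)))%:E *
    (expR (- (kap * quad Q (y - mu)) / 2))%:E)%E.
have AMGM y : ((h y)%:E * (expR (- quad Q0 (y - b) / 2))%:E <= bound y)%E.
  rewrite /bound -!EFinM -EFinD lee_fin.
  set q := quad Q y; set q0 := quad Q0 (y - b).
  have -> : expR (- q0 / 2) = expR (- q / 4) * expR (q / 4 - q0 / 2).
    by rewrite -expRD; congr expR; lra.
  have -> : expR (- q / 2) = expR (- q / 4) ^+ 2.
    by rewrite expr2 -expRD; congr expR; lra.
  set A := expR (- q / 4); set B := expR (q / 4 - q0 / 2).
  have BB : B ^+ 2 <= expR (quad Q b / (1 - delta)) * expR (- (kap * quad Q (y - mu)) / 2).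
    rewrite expr2 -!expRD ler_expR /q0.
    have := lowQ (y - b).
    have -> : quad Q (y - mu) = q - 2 * (2 / (1 - delta)) * (y^T *m Q *m b) ord0 ord0 +
        (2 / (1 - delta)) ^+ 2 * quad Q b.
      by rewrite quadB// quadZ /mu -scalemxAr mxE; rewrite -/q; ring.
    rewrite quadB// -/q kapE.
    set z := (_ *m b) _ _; set D := quad Q b; set q' := quad Q0 _ => H.
    have -> : D / (1 - delta) + - ((1 - delta) / (1 + delta) *
       (q - 2 * (2 / (1 - delta)) * z + (2 / (1 - delta)) ^+ 2 * D)) / 2 =
       q / 2 - (q - 2 * z + D) / (1 + delta).
      by field; rewrite !gt_eqF.
    lra.
  have AB : h y * A * B <= s ^+ 2 / 2 * (h y ^+ 2 * A ^+ 2) + s ^- 2 / 2 * B ^+ 2.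
    rewrite -subr_ge0.
    have -> : s ^+ 2 / 2 * (h y ^+ 2 * A ^+ 2) + s ^- 2 / 2 * B ^+ 2 - h y * A * B =
       (s * (h y * A) - s^-1 * B) ^+ 2 / 2 by field; rewrite gt_eqF.
    by rewrite divr_ge0 ?sqr_ge0.
  rewrite [h y * (A * B)]mulrA; apply: (le_trans AB); rewrite lerD2l -[leRHS]mulrA.
  by rewrite ler_wpM2l// divr_ge0// invr_ge0 sqr_ge0.
pose U y := ((h y ^+ 2)%:E * (expR (- quad Q y / 2))%:E)%E.
pose V y := (expR (- (kap * quad Q y) / 2))%:E.
have U0 y : (0 <= U y)%E by rewrite /U -EFinM lee_fin mulr_ge0 ?expR_ge0 ?sqr_ge0.
have V0 y : (0 <= V y)%E by rewrite lee_fin expR_ge0.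
have mU : borel U by apply: borelM => //; exact: borel_expR_quad.
have mV : borel V.
  rewrite /V (_ : (fun y => _) = (fun y => (expR (- quad (kap *: Q) y / 2))%:E)).
    exact: borel_expR_quad.
  by apply/funext => y; rewrite quad_scale.
have mVmu : borel (fun y => V (y - mu)) by exact: (@borel_translate _ _ (- mu) _ mV).
have sq0 : (0 <= (s ^+ 2 / 2)%:E)%E by rewrite lee_fin divr_ge0// sqr_ge0.
pose k2 := s ^- 2 / 2 * expR (quad Q b / (1 - delta)).
have k20 : (0 <= k2%:E)%E.
  by rewrite lee_fin mulr_ge0 ?expR_ge0// divr_ge0// invr_ge0 sqr_ge0.
have bU : borel (fun y => (s ^+ 2 / 2)%:E * U y)%E.
  by apply: borelM => // d T f mf; exact: measurable_cst.
have bV : borel (fun y => k2%:E * V (y - mu)%R)%E.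
  by apply: borelM => // d T f mf; exact: measurable_cst.
have mlhs : borel (fun y => (h y)%:E * (expR (- quad Q0 (y - b) / 2))%:E)%E.
  by apply: borelM => //; exact: (@borel_translate _ _ (- b) _ (@borel_expR_quad _ _ Q0)).
have bnd : (lebint (fun y => (h y)%:E * (expR (- quad Q0 (y - b) / 2))%:E) <=
    (s ^+ 2 / 2)%:E * lebint U + (k2 * kap `^ (- (m%:R / 2)) / c)%:E)%E.
  apply: (@le_trans _ _ (lebint bound)).
    apply: le_lebint => //.
    - by move=> y; rewrite -EFinM lee_fin mulr_ge0 ?expR_ge0.
    - by move=> d T f mf; apply: emeasurable_funD; [exact: bU|exact: bV].
  rewrite /bound (lebintD _ _ bU bV); [|by move=> y; rewrite mule_ge0|by move=> y; rewrite mule_ge0 ?V0].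
  rewrite lebintZl// (lebintZl k20 (fun y => V0 _) mVmu).
  rewrite (lebint_translate (- mu) V0 mV) /V lebint_expR_scale// gQ.
  by rewrite -!EFinM -mulrA mulrA.
have lU : (c%:E * lebint U <= a%:E)%E by [].
have LU0 : (0 <= lebint U)%E by exact: lebint_ge0.
clearbody U; move: LU0 lU bnd; move: (lebint U) => [l| |]; last first.
- by [].
- by rewrite gt0_muley ?lte_fin// leye_eq.
move=> l0; rewrite -!EFinM -EFinD !lee_fin in l0 * => lU bnd.
have c0c : c0 <= (1 - delta) `^ (- (m%:R / 2)) * c.
  have : (lebint (fun y => (expR (- ((1 - delta)^-1 * quad Q y) / 2))%:E) <=
          lebint (fun y => (expR (- quad Q0 y / 2))%:E))%E.
    apply: le_lebint.
    - by move=> y; rewrite lee_fin expR_ge0.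
    - rewrite (_ : (fun y => _) = (fun y => (expR (- quad ((1 - delta)^-1 *: Q) y / 2))%:E)).
        exact: borel_expR_quad.
      by apply/funext => y; rewrite quad_scale.
    - exact: borel_expR_quad.
    - by move=> y; rewrite lee_fin ler_expR; have := upQ y; lra.
  rewrite lebint_expR_scale ?invr_gt0// gQ gQ0 -EFinM lee_fin.
  have -> : (1 - delta)^-1 `^ (- (m%:R / 2)) = ((1 - delta) `^ (- (m%:R / 2)))^-1.
    by rewrite -powR_inv1 ?ltW// -powRrM powRN invrK; congr (_ `^ _); ring.
  rewrite -invfM lef_pV2// posrE mulr_gt0 ?powR_gt0//.
set L := lebint _ in bnd *.
apply: (@le_trans _ _ (c0 * (s ^+ 2 / 2 * l + k2 * kap `^ (- (m%:R / 2)) / c))%:E).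
  by rewrite EFinM lee_wpmul2l// lee_fin ltW.
rewrite lee_fin; set p := _ `^ _ in c0c.
pose q := a `^ (1 / 2); pose e := E `^ (1 / 2).
have q0 : 0 < q by rewrite powR_gt0.
have e0 : 0 < e by rewrite powR_gt0.
have qq : q ^+ 2 = a by rewrite -powR_mulrn ?ltW// -powRrM div1r mulVf// powRr1 ?ltW.
have ee : e ^+ 2 = E by rewrite -powR_mulrn ?ltW// -powRrM div1r mulVf// powRr1 ?ltW.
have sqe : s ^+ 2 = e / q.
  have : (s ^+ 2) ^+ 2 = (e / q) ^+ 2.
    rewrite expr_div_n qq ee -exprM -powR_mulrn ?ltW// -powRrM.
    by rewrite div1r mulVf// powRr1// divr_ge0 ?ltW.
  by move/eqP; rewrite eqrXn2// ?sqr_ge0 ?divr_ge0 ?ltW// => /eqP.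
have eE : e = expR (quad Q b / (2 * (1 - delta))) *
    ((1 - delta) `^ (- (m%:R / 4)) * (1 + delta) `^ (m%:R / 4)).
  rewrite /e /E powRM ?expR_ge0 ?powR_ge0// -expRM -powRrM; congr (expR _ * _).
    by field; rewrite gt_eqF.
  rewrite kapE powRM ?invr_ge0 ?ltW// -[(1 + delta)^-1]powR_inv1 ?ltW// -powRrM.
  by congr (_ `^ _ * _ `^ _); field.
have final : c0 * (s ^+ 2 / 2 * l + k2 * kap `^ (- (m%:R / 2)) / c) <= p * (q * e).
  have -> : k2 * kap `^ (- (m%:R / 2)) / c = (e / q)^-1 / 2 * e ^+ 2 / c.
    by rewrite ee /k2 sqe /E; ring.
  rewrite sqe; have lc : l <= q ^+ 2 / c by rewrite ler_pdivlMr// mulrC qq.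
  apply: (@le_trans _ _ (p * c * (e / q / 2 * (q ^+ 2 / c) + (e / q)^-1 / 2 * e ^+ 2 / c))).
    apply: ler_pM => //; first exact: ltW.
      apply: addr_ge0; first by apply: mulr_ge0 => //; rewrite ltW// !divr_gt0.
      by rewrite ltW// divr_gt0// mulr_gt0 ?exprn_gt0// divr_gt0// invr_gt0 divr_gt0.
    by rewrite lerD2r ler_wpM2l// divr_ge0// divr_ge0 ?ltW.
  rewrite le_eqVlt; apply/orP; left; apply/eqP; field.
  by rewrite !gt_eqF.
apply: (le_trans final); rewrite le_eqVlt; apply/orP; left; apply/eqP.
have -> : (1 - delta) `^ (- (3 * m%:R / 4)) = p * (1 - delta) `^ (- (m%:R / 4)).
  rewrite /p -powRD; last by apply/implyP => _; rewrite gt_eqF.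
  by congr (_ `^ _); field.
by rewrite eE -/q; ring.
Qed.

End change_of_measure.

(** * Moments of the chi-squared law *)

Section gamma_integral.
Context {R : realType}.
Local Notation mu := (@lebesgue_measure R).

Definition gamma_fun (a t : R) : R :=
  if 0 < t then t `^ (a - 1) * expR (- t) else 0.

(** The Gamma integral with values in the extended reals: its finiteness is
obtained only later, by comparison with Gaussian moments. *)
Definition gamma_int (a : R) : \bar R := (\int[mu]_t (gamma_fun a t)%:E)%E.

Lemma gamma_fun_ge0 a t : 0 <= gamma_fun a t.
Proof. by rewrite /gamma_fun; case: ifP => // _; rewrite mulr_ge0 ?powR_ge0 ?expR_ge0. Qed.

Lemma GammaE a : Gamma a = fine (gamma_int a).
Proof.
rewrite /Gamma /Rintegral integral_mkcond; congr fine.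
apply: eq_integral => t _; rewrite patchE /gamma_fun.
by case: ifPn => [|/negP]; rewrite inE/= in_itv/= andbT; [move=> ->|case: ifP].
Qed.

Lemma measurable_gamma_fun a : measurable_fun [set: R] (gamma_fun a).
Proof.
apply: measurable_fun_ifT => //; first exact: measurable_fun_ltr.
apply: measurable_funM; first exact: measurable_powR.
by apply: measurableT_comp => //; exact: measurable_funN.
Qed.

Lemma gamma_int_ge0 a : (0 <= gamma_int a)%E.
Proof. by apply: integral_ge0 => t _; rewrite lee_fin gamma_fun_ge0. Qed.

Lemma gamma_int_gt0 a : (0 < gamma_int a)%E.
Proof.
pose m : R := 2 `^ (- `|a - 1|) * expR (- 2).
have m0 : 0 < m by rewrite mulr_gt0 ?powR_gt0 ?expR_gt0.
apply: (@lt_le_trans _ _ (\int[mu]_(t in `[1%R, 2%R]) m%:E)%E).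
  rewrite integral_cst//= lebesgue_measure_itv/= lte_fin ltr1n/= -EFinB -EFinM.
  by rewrite lte_fin mulr_gt0//; lra.
apply: (@le_trans _ _ (\int[mu]_(t in `[1%R, 2%R]) (gamma_fun a t)%:E)%E).
  apply: ge0_le_integral => //=.
  - by move=> t _; rewrite lee_fin ltW.
  - by apply: measurable_funTS; apply/measurable_EFinP; exact: measurable_gamma_fun.
  move=> t; rewrite in_itv/= => /andP[t1 t2]; rewrite lee_fin /gamma_fun.
  rewrite (lt_le_trans ltr01 t1) /m ler_pM ?powR_ge0 ?expR_ge0//; last first.
    by rewrite ler_expR lerN2.
  apply: (@le_trans _ _ (t `^ (- `|a - 1|))).
    rewrite !powRN lef_pV2 ?posrE ?powR_gt0//; last exact: lt_le_trans ltr01 t1.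
    by rewrite ge0_ler_powR// nnegrE// (le_trans _ t1).
  by rewrite ler_powR// lerNl -normrN ler_norm.
apply: ge0_subset_integral => //.
  by apply/measurable_EFinP; exact: measurable_gamma_fun.
by move=> t _; rewrite lee_fin gamma_fun_ge0.
Qed.

End gamma_integral.

Section chi_square_moments.
Context {R : realType} (p : nat) (Q : 'M[R]_p).
Hypothesis Q0 : forall y, 0 <= quad Q y.
Local Notation mu := (@lebesgue_measure R).
Local Notation q := (quad Q).

(** Moments of q under the density proportional to exp (- q / 2), for a nonnegative
quadratic form q on R^p.  The moment of order r is the integral of W r over s
and y, since W r is constant in s on an interval of length q y.  The substitution
y -> sqrt s y turns W into W', where homogeneity has separated the variables:
integrated over s first, W' gives a Gamma integral times an integral over y
that does not depend on r.  Hence the ratio of the moments of orders r and 0 is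
a ratio of Gamma values. *)
Let W (r s : R) (y : 'cV[R]_p) : R :=
  if (0 < s) && (s <= q y) then q y `^ (r - 1) * expR (- q y / 2) else 0.

Let W' (r s : R) (y : 'cV[R]_p) : R :=
  if (0 < s) && (1 <= q y) then
    s `^ (p%:R / 2 + r - 1) * (q y `^ (r - 1) * expR (- (s * q y) / 2)) else 0.

Let W_ge0 r s y : (0 <= (W r s y)%:E)%E.
Proof.
by rewrite lee_fin /W; case: ifP => // _; rewrite mulr_ge0 ?powR_ge0 ?expR_ge0.
Qed.

Let W'_ge0 r s y : (0 <= (W' r s y)%:E)%E.
Proof.
rewrite lee_fin /W'; case: ifP => // _.
by rewrite !mulr_ge0 ?powR_ge0 ?expR_ge0.
Qed.

Let borel_W r : borel_in (fun (s : measurableTypeR R) y => (W r s y)%:E).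
Proof.
move=> d T g f mg mf; apply/measurable_EFinP.
have mq := measurable_quad Q mf.
have mg' : measurable_fun [set: T] (g : T -> R) by exact: mg.
apply: measurable_fun_ifT => //.
  by apply: measurable_and; [exact: measurable_fun_ltr|exact: measurable_fun_ler].
apply: measurable_funM; first exact: (measurableT_comp (measurable_powR _)).
by apply: measurableT_comp => //; apply: measurable_funM => //; exact: measurable_funN.
Qed.

Let borel_W' r : borel_in (fun (s : measurableTypeR R) y => (W' r s y)%:E).
Proof.
move=> d T g f mg mf; apply/measurable_EFinP.
have mq := measurable_quad Q mf.
have mg' : measurable_fun [set: T] (g : T -> R) by exact: mg.
apply: measurable_fun_ifT => //.
  by apply: measurable_and; [exact: measurable_fun_ltr|exact: measurable_fun_ler].
apply: measurable_funM; first exact: (measurableT_comp (measurable_powR _)).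
apply: measurable_funM; first exact: (measurableT_comp (measurable_powR _)).
apply: measurableT_comp => //; apply: measurable_funM => //.
by apply: measurable_funN; exact: measurable_funM.
Qed.

Let int_W r y : (\int[mu]_s (W r s y)%:E)%E =
  (if 0 < q y then q y `^ r * expR (- q y / 2) else 0)%:E.
Proof.
pose k := q y `^ (r - 1) * expR (- q y / 2).
transitivity (\int[mu]_(s in `]0%R, q y]) k%:E)%E.
  rewrite [RHS]integral_mkcond; apply: eq_integral => s _; rewrite patchE /W.
  have -> : (s \in `]0, q y]%classic) = (0 < s) && (s <= q y).
    by apply/idP/idP; rewrite inE/= in_itv.
  by case: ifP.
rewrite integral_cst//= lebesgue_measure_itv/= lte_fin.
have [q0|q0] := ltP 0 (q y); last by rewrite mule0.
rewrite -EFinB subr0 -EFinM; congr (_%:E); rewrite /k mulrAC; congr (_ * _).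
rewrite -[X in _ * X]powRr1 ?ltW// -powRD ?subrK//.
by rewrite (gt_eqF q0) implybT.
Qed.

Let lebint_W r s :
  lebint (fun y => (W r s y)%:E) = lebint (fun y => (W' r s y)%:E).
Proof.
have [s0|s0] := ltP 0 s; last first.
  by apply: eq_lebint => y; rewrite /W /W' ltNge s0.
have t0 : 0 < s `^ (1 / 2) by exact: powR_gt0.
rewrite -(lebint_scale t0 (W_ge0 r s) (borel_in_at s (borel_W r))).
rewrite -lebintZl//; last 2 first.
- by rewrite lee_fin exprn_ge0// ltW.
- move=> d T f mf; apply: (borel_W r (g := fun=> s)) => //.
  exact: coord_measurableZ.
apply: eq_lebint => y; rewrite -EFinM; congr (_%:E).
have -> : (s `^ (1 / 2)) ^+ p = s `^ (p%:R / 2).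
  by rewrite -powR_mulrn ?ltW// -powRrM; congr (_ `^ _); field.
rewrite /W /W' s0/= quadZ.
have -> : (s `^ (1 / 2)) ^+ 2 = s.
  by rewrite -powR_mulrn ?ltW// -powRrM div1r mulVf// powRr1// ltW.
rewrite -[X in X <= _]mulr1 ler_pM2l//; case: ifP => _; last by rewrite mulr0.
rewrite (powRM _ (ltW s0) (Q0 y)) -!mulrA [LHS]mulrA -powRD; last by rewrite (gt_eqF s0) implybT.
by rewrite addrA.
Qed.

Let int_W' r y : (\int[mu]_s (W' r s y)%:E)%E =
  ((2 `^ (p%:R / 2 + r))%:E * gamma_int (p%:R / 2 + r)%R *
   (if (1 <= q y)%R then q y `^ (- 1 - p%:R / 2) else 0)%:E)%E.
Proof.
set A := p%:R / 2 + r; rewrite /W'.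
have [q1|q1] := leP 1 (q y); last first.
  by rewrite mule0 integral0_eq// => s _; rewrite andbF.
have q0 : 0 < q y / 2 by lra.
have mg : measurable_fun [set: R] (fun t => (gamma_fun A t)%:E).
  by apply/measurable_EFinP; exact: measurable_gamma_fun.
have g0 t : (0 <= (gamma_fun A t)%:E)%E by rewrite lee_fin gamma_fun_ge0.
rewrite /gamma_int -(integral_lebesgue_scale_pos q0 mg g0).
rewrite !muleA -EFinM muleAC -EFinM -ge0_integralZl//; last 2 first.
- by apply: (measurableT_comp mg); exact: measurable_funM.
- by rewrite lee_fin !mulr_ge0 ?powR_ge0// ltW.
apply: eq_integral => s _; rewrite andbT -EFinM /gamma_fun pmulr_rgt0//.
case: ifP => s0; last by rewrite mulr0.
have yq : 0 < q y by lra.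
have E : 2 `^ A * (q y / 2) * q y `^ (- 1 - p%:R / 2) * (q y / 2) `^ (A - 1) = q y `^ (r - 1).
  have E1 : q y / 2 * (q y / 2) `^ (A - 1) = q y `^ A * (2 `^ A)^-1.
    rewrite -[X in X * _]powRr1 ?ltW// -powRD; last by rewrite (gt_eqF q0) implybT.
    rewrite addrC subrK powRM ?invr_ge0 ?ltW// -[2^-1]powR_inv1// -powRrM mulN1r.
    by rewrite powRN.
  have -> : 2 `^ A * (q y / 2) * q y `^ (- 1 - p%:R / 2) * (q y / 2) `^ (A - 1) =
     2 `^ A * q y `^ (- 1 - p%:R / 2) * (q y / 2 * (q y / 2) `^ (A - 1)) by ring.
  rewrite E1 [q y `^ A * _]mulrC mulrACA mulfV ?gt_eqF ?powR_gt0// mul1r.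
  rewrite -powRD; last by rewrite (gt_eqF yq) implybT.
  by congr (_ `^ _); rewrite /A; ring.
rewrite powRM ?ltW// -E; congr (_%:E).
have -> : - (s * q y) / 2 = - (q y / 2 * s) by ring.
ring.
Qed.

Let tail (y : 'cV[R]_p) : \bar R :=
  (if 1 <= q y then q y `^ (- 1 - p%:R / 2) else 0)%:E.

Let tail_ge0 y : (0 <= tail y)%E.
Proof. by rewrite lee_fin; case: ifP => // _; exact: powR_ge0. Qed.

Let borel_tail : borel tail.
Proof.
move=> d T f mf; apply/measurable_EFinP; have mq := measurable_quad Q mf.
apply: measurable_fun_ifT => //; first exact: measurable_fun_ler.
exact: (measurableT_comp (measurable_powR _)).
Qed.

(** The integrand vanishes where q does, as the integral of W over s does; for
r = 0 this removes the zero set of q. *)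
Definition cut_moment (r : R) (y : 'cV[R]_p) : R :=
  if 0 < q y then q y `^ r * expR (- q y / 2) else 0.

Lemma cut_moment_ge0 r y : (0 <= (cut_moment r y)%:E)%E.
Proof.
by rewrite lee_fin /cut_moment; case: ifP => // _; rewrite mulr_ge0 ?powR_ge0 ?expR_ge0.
Qed.

Lemma borel_cut_moment r : borel (fun y => (cut_moment r y)%:E).
Proof.
move=> d T f mf; apply/measurable_EFinP; have mq := measurable_quad Q mf.
apply: measurable_fun_ifT => //; first exact: measurable_fun_ltr.
apply: measurable_funM; first exact: (measurableT_comp (measurable_powR _)).
by apply: measurableT_comp => //; apply: measurable_funM => //; exact: measurable_funN.
Qed.

Lemma lebint_cut_moment r :
  lebint (fun y => (cut_moment r y)%:E) =
  ((2 `^ (p%:R / 2 + r))%:E * gamma_int (p%:R / 2 + r)%R * lebint tail)%E.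
Proof.
rewrite -lebintZl//; last by rewrite mule_ge0 ?gamma_int_ge0// lee_fin powR_ge0.
under eq_lebint do rewrite /cut_moment -int_W.
under [RHS]eq_lebint do rewrite -int_W'.
rewrite -(lebint_tonelli mu (W_ge0 r) (borel_W r)).
rewrite -(lebint_tonelli mu (W'_ge0 r) (borel_W' r)).
by apply: eq_integral => s _; exact: lebint_W.
Qed.

Let zero_set (y : 'cV[R]_p) : \bar R := (if 0 < q y then 0 else 1)%:E.

Let zero_set_ge0 y : (0 <= zero_set y)%E.
Proof. by rewrite lee_fin; case: ifP. Qed.

Let borel_zero_set : borel zero_set.
Proof.
move=> d T f mf; apply/measurable_EFinP; have mq := measurable_quad Q mf.
by apply: measurable_fun_ifT => //; exact: measurable_fun_ltr.
Qed.

Hypothesis p_gt0 : (0 < p)%N.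
Variable c : R.
Hypothesis c_gt0 : 0 < c.
Hypothesis Qc : lebint (fun y => (expR (- q y / 2))%:E) = (c^-1)%:E.

(** The zero set of q is a cone: doubling the vectors multiplies its volume by 2^p
and leaves it unchanged, and this volume is finite because exp (- q / 2) = 1 on
the cone. *)
Lemma lebint_zero_set : lebint zero_set = 0%E.
Proof.
have fin : lebint zero_set \is a fin_num.
  rewrite ge0_fin_numE ?lebint_ge0//; apply: le_lt_trans (ltry c^-1).
  rewrite -Qc; apply: le_lebint => //; first exact: borel_expR_quad.
  move=> y; rewrite lee_fin; case: ifP; first by rewrite expR_ge0.
  by move=> /negbT; rewrite -leNgt => qy; rewrite -[leLHS]expR0 ler_expR; lra.
have two0 : 0 < 2 :> R by [].
have := lebint_scale two0 zero_set_ge0 borel_zero_set.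
have -> : lebint (fun y => zero_set (2 *: y)) = lebint zero_set.
  by apply: eq_lebint => y; rewrite /zero_set quadZ pmulr_rgt0//.
rewrite -(fineK fin) -EFinM => -[] N2; congr (_%:E); apply/eqP.
have : (2 ^+ p - 1) * fine (lebint zero_set) == 0.
  by rewrite mulrBl N2 mul1r subrr.
rewrite mulf_eq0 => /orP[|//]; rewrite subr_eq0 => /eqP E.
have : 1 < 2 ^+ p :> R by rewrite exprn_egt1// ?ltr1n// -lt0n.
by rewrite E ltxx.
Qed.

Lemma lebint_cut_moment0 : lebint (fun y => (cut_moment 0 y)%:E) = (c^-1)%:E.
Proof.
rewrite -Qc -[LHS]adde0 -lebint_zero_set -lebintD//.
- apply: eq_lebint => y; rewrite -EFinD /cut_moment; congr (_%:E).
  case: ifPn; first by rewrite powRr0 mul1r addr0.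
  rewrite -leNgt => qy; have -> : q y = 0 by apply/le_anti; rewrite qy Q0.
  by rewrite add0r oppr0 mul0r expR0.
- exact: cut_moment_ge0.
- exact: borel_cut_moment.
Qed.

(** Powers of q are dominated by exp (q / 4). *)
Lemma lebint_moment_lty (r : R) : 0 < r -> (lebint (fun y => (cut_moment r y)%:E) < +oo)%E.
Proof.
move=> r0; pose M := (4 * r) `^ r.
have bd y : cut_moment r y <= M * expR (- (2^-1 * q y) / 2).
  rewrite /cut_moment; case: ifPn => q0; last by rewrite mulr_ge0 ?powR_ge0 ?expR_ge0.
  have -> : expR (- (2^-1 * q y) / 2) = expR (q y / 4) * expR (- q y / 2).
    by rewrite -expRD; congr expR; lra.
  rewrite mulrA ler_wpM2r ?expR_ge0//.
  have -> : q y / 4 = q y / (4 * r) * r by field; rewrite gt_eqF.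
  have r4 : 0 < 4 * r by rewrite mulr_gt0.
  rewrite /M expRM -powRM ?expR_ge0 ?(ltW r4)//.
  apply: ge0_ler_powR; rewrite ?nnegrE ?(ltW r0) ?(ltW q0) ?mulr_ge0 ?expR_ge0 ?(ltW r4)//.
    exact: ltW r0.
  rewrite -ler_pdivrMl// mulrC; apply: le_trans (expR_ge1Dx _).
  by rewrite lerDr.
apply: (@le_lt_trans _ _ (M%:E * lebint (fun y => (expR (- (2^-1 * q y) / 2))%:E))%E).
  have mE : borel (fun y => (expR (- (2^-1 * q y) / 2))%:E).
    rewrite (_ : (fun y => _) = (fun y => (expR (- quad (2^-1 *: Q) y / 2))%:E)).
      exact: borel_expR_quad.
    by apply/funext => y; rewrite quad_scale.
  rewrite -(lebintZl _ _ mE); [|by rewrite lee_fin powR_ge0|by move=> y; rewrite lee_fin expR_ge0].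
  apply: le_lebint => //.
  - exact: cut_moment_ge0.
  - exact: borel_cut_moment.
  - by apply: borelM => // d T f mf; exact: measurable_cst.
have h2 : 0 < 2^-1 :> R by rewrite invr_gt0.
by rewrite (lebint_expR_scale Q h2) Qc -!EFinM ltry.
Qed.

(** The moment of order 0 is finite and positive and factors into these
integrals. *)
Lemma gamma_tail_fin :
  [/\ gamma_int (p%:R / 2 : R) \is a fin_num, lebint tail \is a fin_num &
      (0 < lebint tail)%E].
Proof.
have := lebint_cut_moment 0; rewrite lebint_cut_moment0 addr0.
have g0 := gamma_int_gt0 (p%:R / 2 : R).
have t0 : (0 <= lebint tail)%E by exact: lebint_ge0.
have a0 : (0 < (2 `^ (p%:R / 2 : R))%:E)%E by rewrite lte_fin powR_gt0.
have ag0 := mule_gt0 a0 g0.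
move=> E; have tp : (0 < lebint tail)%E.
  rewrite lt_neqAle t0 andbT eq_sym; apply/eqP => T0; move: E; rewrite T0 mule0.
  by move=> [] /eqP; rewrite invr_eq0 gt_eqF.
split => //; rewrite ge0_fin_numE ?ltW// ltey; apply/eqP => Y; move: E; rewrite Y.
  by rewrite gt0_muley// gt0_mulye.
by rewrite gt0_muley.
Qed.

Lemma Gamma_gt0 (r : R) : 0 <= r ->
  0 < Gamma (p%:R / 2 + r) :> R /\ gamma_int (p%:R / 2 + r) = (Gamma (p%:R / 2 + r))%:E.
Proof.
move=> r0; have [gf tf tp] := gamma_tail_fin.
have g0 := gamma_int_gt0 (p%:R / 2 + r : R).
have gf' : gamma_int (p%:R / 2 + r) \is a fin_num.
  move: r0; rewrite le_eqVlt => /predU1P[<-|r0]; first by rewrite addr0.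
  have := lebint_moment_lty r0; rewrite lebint_cut_moment.
  rewrite ge0_fin_numE ?gamma_int_ge0// => H; rewrite ltey; apply/eqP => Y; move: H.
  by rewrite Y gt0_muley ?lte_fin ?powR_gt0// gt0_mulye.
by rewrite GammaE fineK//; split => //; rewrite fine_gt0// g0 -ge0_fin_numE ?ltW.
Qed.

Lemma chi_square_moment (r : R) : 0 < r ->
  0 < C p r /\
  (c%:E * lebint (fun y => (q y `^ r)%:E * (expR (- q y / 2))%:E) = (C p r)%:E)%E.
Proof.
move=> r0; have [G0 gE] := Gamma_gt0 (lexx 0); rewrite addr0 in G0 gE.
have [Gr grE] := Gamma_gt0 (ltW r0).
have CE : C p r = 2 `^ r * Gamma (p%:R / 2 + r) / Gamma (p%:R / 2).
  by rewrite /C addrC.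
split; first by rewrite CE divr_gt0// mulr_gt0// powR_gt0.
have -> : lebint (fun y => ((q y `^ r)%:E * (expR (- q y / 2))%:E)%E) =
          lebint (fun y => (cut_moment r y)%:E).
  apply: eq_lebint => y; rewrite -EFinM /cut_moment; congr (_%:E).
  case: ifPn => //; rewrite -leNgt => qy.
  have -> : q y = 0 by apply/le_anti; rewrite qy Q0.
  by rewrite powR0 ?mul0r// gt_eqF.
have [_ tf tp] := gamma_tail_fin.
rewrite lebint_cut_moment grE CE -(fineK tf) -!EFinM; congr (_%:E).
have := lebint_cut_moment 0; rewrite lebint_cut_moment0 addr0 gE -(fineK tf) -!EFinM.
move=> [] cE; rewrite powRD; last by apply/implyP => _; rewrite gt_eqF.
apply: (mulfI (x := c^-1)); first by rewrite invr_eq0 gt_eqF.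
rewrite mulKf ?gt_eqF// cE.
by field; rewrite gt_eqF.
Qed.

End chi_square_moments.

(** * Precision matrices of the local estimators *)

Section positive_definite.
Context {R : realType}.

Lemma diag_mul n (s t : 'I_n -> R) :
  diag s *m diag t = diag (fun i => s i * t i).
Proof.
by rewrite /diag mulmx_diag; congr diag_mx; apply/rowP => i; rewrite !mxE.
Qed.

Lemma diag_tr n (s : 'I_n -> R) : (diag s)^T = diag s.
Proof. exact: tr_diag_mx. Qed.

Lemma diag_mulmxE n (s : 'I_n -> R) (v : 'cV[R]_n) i :
  (diag s *m v) i ord0 = s i * v i ord0.
Proof. by rewrite /diag mul_diag_mx !mxE. Qed.

Lemma diag_inv n (s : 'I_n -> R) : (forall i, s i != 0) ->
  invmx (diag s) = diag (fun i => (s i)^-1).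
Proof.
move=> s0; have ds : diag s *m diag (fun i => (s i)^-1) = 1%:M.
  rewrite diag_mul -diag_const_mx; congr diag_mx.
  by apply/rowP => i; rewrite !mxE mulfV.
have [us _] := mulmx1_unit ds.
by rewrite -[LHS]mulmx1 -ds mulmxA mulVmx// mul1mx.
Qed.

Lemma quad_diag n (s : 'I_n -> R) (v : 'cV[R]_n) :
  quad (diag s) v = \sum_i s i * v i ord0 ^+ 2.
Proof.
by rewrite quadE; apply: eq_bigr => i _; rewrite diag_mulmxE; ring.
Qed.

Lemma pos_quad_unit n (A : 'M[R]_n) :
  (forall v, quad A v = 0 -> v = 0) -> A \in unitmx.
Proof.
move=> A0; rewrite -row_free_unit -kermx_eq0; apply/eqP/row_matrixP => i.
rewrite row0; apply: trmx_inj; rewrite trmx0; apply: A0.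
by rewrite /quad trmxK -row_mul mulmx_ker row0 mul0mx mxE.
Qed.

Lemma row_free_trmx_inj m n (M : 'M[R]_(m, n)) :
  (forall v : 'cV[R]_m, M^T *m v = 0 -> v = 0) -> row_free M.
Proof.
move=> M0; rewrite -kermx_eq0; apply/eqP/row_matrixP => i.
rewrite row0; apply: trmx_inj; rewrite trmx0; apply: M0.
by rewrite -trmx_mul -row_mul mulmx_ker row0 trmx0.
Qed.

Lemma quad_gram_diag m n (M : 'M[R]_(m, n)) (s : 'I_n -> R) (v : 'cV[R]_m) :
  quad (M *m diag s *m (M *m diag s)^T) v =
  \sum_i s i ^+ 2 * (M^T *m v) i ord0 ^+ 2.
Proof.
rewrite -quad_diag quad_mulmx trmxK; congr quad.
rewrite trmx_mul diag_tr !mulmxA -[_ *m diag s *m diag s]mulmxA diag_mul.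
by congr (_ *m diag _ *m _); apply/funext => i; rewrite expr2.
Qed.

Lemma row_free_mul_diag m n (M : 'M[R]_(m, n)) (s : 'I_n -> R) :
  (forall i, s i != 0) -> row_free M -> row_free (M *m diag s).
Proof.
move=> s0 fM; rewrite /row_free mxrankMfree// row_free_unit.
have ds : diag s *m diag (fun i => (s i)^-1) = 1%:M.
  rewrite diag_mul -diag_const_mx; congr diag_mx.
  by apply/rowP => i; rewrite !mxE mulfV.
by have [] := mulmx1_unit ds.
Qed.

Lemma gram_tr m n (M : 'M[R]_(m, n)) : (M *m M^T)^T = M *m M^T.
Proof. by rewrite trmx_mul trmxK. Qed.

Lemma quad_gram_ge0 m n (M : 'M[R]_(m, n)) v : 0 <= quad (M *m M^T) v.
Proof.
have := quad1_ge0 (M^T *m v); rewrite quad_mulmx trmxK mulmx1.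
by [].
Qed.

Lemma quad_gram_inv_ge0 m n (M : 'M[R]_(m, n)) v :
  row_free M -> 0 <= quad (invmx (M *m M^T)) v.
Proof.
move=> fM; set S := M *m M^T; have uS := gram_unit fM.
have := quad_gram_ge0 M (invmx S *m v).
by rewrite quad_mulmx trmx_inv gram_tr mulVmx// mul1mx.
Qed.

Lemma quad_gram_inv_comparison m n (M : 'M[R]_(m, n)) (s s0 : 'I_n -> R)
    (delta : R) :
  row_free M -> (forall i, 0 < s i) -> (forall i, 0 < s0 i) ->
  0 <= delta < 1 ->
  (forall i, 1 - delta <= s0 i ^+ 2 / s i ^+ 2 <= 1 + delta) ->
  let Q := invmx (M *m diag s *m (M *m diag s)^T) in
  let Q0 := invmx (M *m diag s0 *m (M *m diag s0)^T) in
  forall y, quad Q y / (1 + delta) <= quad Q0 y <= quad Q y / (1 - delta).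
Proof.
move=> fM sp s0p /andP[d0 d1] A3 Q Q0 y.
have fS : row_free (M *m diag s) by apply: row_free_mul_diag => // i; rewrite gt_eqF.
have fS0 : row_free (M *m diag s0) by apply: row_free_mul_diag => // i; rewrite gt_eqF.
set S := M *m diag s *m _ in Q *; set S0 := M *m diag s0 *m _ in Q0 *.
have uS : S \in unitmx by exact: gram_unit.
have uS0 : S0 \in unitmx by exact: gram_unit.
have uZ (a : R) : 0 < a -> a *: S \in unitmx.
  by move=> a0; rewrite unitmxZ// unitfE gt_eqF.
have bd u : (1 - delta) * quad S u <= quad S0 u <= (1 + delta) * quad S u.
  rewrite !quad_gram_diag !mulr_sumr; apply/andP; split; apply: ler_sum => i _;
    have /andP[lo hi] := A3 i; rewrite mulrA ler_wpM2r ?sqr_ge0//.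
    by rewrite -ler_pdivlMr// exprn_gt0.
  by rewrite -ler_pdivrMr// exprn_gt0.
have QE (a : R) : 0 < a -> quad (invmx (a *: S)) y = quad Q y / a.
  by move=> a0; rewrite invmxZ ?uZ// quad_scale mulrC.
have m1 : 0 < 1 - delta by lra.
have p1 : 0 < 1 + delta by lra.
rewrite -!QE//; apply/andP; split; apply: quad_invmx_antitone => //;
  rewrite ?uZ ?linearZ/= ?gram_tr//.
- by move=> u; exact: quad_gram_ge0.
- by move=> u; rewrite quad_scale; have /andP[] := bd u.
- by move=> u; rewrite quad_scale mulr_ge0 ?quad_gram_ge0// ltW.
- by move=> u; rewrite quad_scale; have /andP[] := bd u.
Qed.

End positive_definite.

Section local_estimators.
Context {R : realType} {n p : nat}.
Variables (sigma : 'I_n -> R) (Psi : 'M[R]_(p, n)) (w : nat -> 'I_n -> R).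
Hypothesis sigma_gt0 : forall i, 0 < sigma i.

Local Notation W := (W sigma w).
Local Notation B := (B sigma Psi w).
Local Notation D := (D sigma Psi w).

Lemma WE k : W k = diag (fun i => w k i / sigma i ^+ 2).
Proof.
rewrite /Defs.W diag_inv; last by move=> i; rewrite gt_eqF.
rewrite !diag_mul; congr diag; apply/funext => i.
by rewrite expr2 invfM; ring.
Qed.

Lemma W_tr k : (W k)^T = W k.
Proof. by rewrite WE diag_tr. Qed.

Lemma B_tr k : (B k)^T = B k.
Proof. by rewrite /Defs.B trmx_mul trmxK [(Psi *m _)^T]trmx_mul W_tr mulmxA. Qed.

Lemma quad_B k v :
  quad (B k) v = \sum_i w k i / sigma i ^+ 2 * (Psi^T *m v) i ord0 ^+ 2.
Proof. by rewrite -quad_diag -WE quad_mulmx trmxK. Qed.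

Variable k : nat.
Hypothesis w1_ge0 : forall i, 0 <= w 1%N i.
Hypothesis w1_le : forall i, w 1%N i <= w k i.
Hypothesis w_le1 : forall i, w k i <= 1.
Hypothesis full_rank : row_free (Psi *m diag (w 1%N)).

Let w_ge0 i : 0 <= w k i. Proof. exact: le_trans (w1_ge0 i) (w1_le i). Qed.

Lemma quad_B_ge0 v : 0 <= quad (B k) v.
Proof.
by rewrite quad_B; apply: sumr_ge0 => i _; rewrite mulr_ge0 ?sqr_ge0 ?divr_ge0 ?sqr_ge0.
Qed.

(** A null vector of B_k has Psi^T v = 0 wherever w_k is positive, hence wherever
w_1 is, and then the full rank condition applies. *)
Lemma quad_B_eq0 v : quad (B k) v = 0 -> v = 0.
Proof.
rewrite quad_B => /eqP; rewrite psumr_eq0; last first.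
  by move=> i _; rewrite mulr_ge0 ?sqr_ge0 ?divr_ge0 ?sqr_ge0.
move=> /allP H; apply: trmx_inj; apply: (row_free_inj full_rank).
rewrite trmx0 mul0mx mulmxA; apply: trmx_inj; rewrite trmx0 trmx_mul diag_tr.
rewrite trmx_mul trmxK; apply/colP => i; rewrite diag_mulmxE [RHS]mxE.
have := H i (mem_index_enum i); rewrite /= mulf_eq0 expf_eq0/= [_ / _ == 0]mulf_eq0 invr_eq0.
rewrite expf_eq0/= (gt_eqF (sigma_gt0 i)) orbF => /orP[/eqP w0|/eqP ->].
  have : w 1%N i = 0 by apply/le_anti; rewrite w1_ge0 -w0 w1_le.
  by move=> ->; rewrite mul0r.
by rewrite mulr0.
Qed.

Lemma B_unit : B k \in unitmx.
Proof. exact/pos_quad_unit/quad_B_eq0. Qed.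

Lemma D_tr : (D k)^T = W k *m Psi^T *m invmx (B k).
Proof.
rewrite /Defs.D trmx_mul W_tr [(invmx _ *m _)^T]trmx_mul trmx_inv B_tr.
by rewrite mulmxA.
Qed.

Lemma D_row_free : row_free (D k).
Proof.
apply: row_free_trmx_inj => v; rewrite D_tr -mulmxA => Dv.
have : quad (B k) (invmx (B k) *m v) = 0.
  have -> x : quad (B k) x = (x^T *m Psi *m (W k *m Psi^T *m x)) ord0 ord0.
    by rewrite /quad /Defs.B !mulmxA.
  by rewrite Dv mulmx0 mxE.
by move=> /quad_B_eq0 /(congr1 (mulmx (B k))); rewrite mulmxA mulmxV ?B_unit// mul1mx mulmx0.
Qed.

(** D_k Sigma D_k^T = B_k^-1 Psi W_k Sigma W_k Psi^T B_k^-1 <= B_k^-1 because the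
weights are at most 1, and inversion is antitone. *)
Lemma quad_B_le_precision v (M := D k *m diag sigma) :
  quad (B k) v <= quad (invmx (M *m M^T)) v.
Proof.
have fM : row_free M.
  by apply: row_free_mul_diag; [move=> i; rewrite gt_eqF|exact: D_row_free].
rewrite -[B k]invmxK; apply: quad_invmx_antitone.
- exact: gram_unit.
- by rewrite unitmx_inv B_unit.
- exact: gram_tr.
- by rewrite trmx_inv B_tr.
- by move=> u; exact: quad_gram_ge0.
move=> u; rewrite quad_gram_diag D_tr.
have -> : quad (invmx (B k)) u = quad (B k) (invmx (B k) *m u).
  by rewrite quad_mulmx trmx_inv B_tr mulVmx ?B_unit// mul1mx.
rewrite quad_B; apply: ler_sum => i _.
have -> : W k *m Psi^T *m invmx (B k) *m u =
    W k *m (Psi^T *m (invmx (B k) *m u)) by rewrite !mulmxA.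
rewrite {1}WE diag_mulmxE exprMn mulrA ler_wpM2r ?sqr_ge0//.
have s0 : sigma i != 0 by rewrite gt_eqF.
have -> : sigma i ^+ 2 * (w k i / sigma i ^+ 2) ^+ 2 =
    w k i / sigma i ^+ 2 * w k i by field.
rewrite -[leRHS]mulr1 ler_wpM2l ?w_le1//.
by rewrite divr_ge0 ?sqr_ge0.
Qed.

End local_estimators.

Section stacked_estimators.
Context {R : realType} {n p : nat}.
Variables (sigma : 'I_n -> R) (Psi : 'M[R]_(p, n)) (w : nat -> 'I_n -> R).

Local Notation D := (D sigma Psi w).

Definition stackD k : 'M[R]_(\sum_(i < k) p, n) := \mxcol_(i < k) D i.+1.

Lemma bigSigmaE k : bigSigma sigma Psi w k =
  stackD k *m diag sigma *m (stackD k *m diag sigma)^T.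
Proof.
have -> : stackD k *m diag sigma *m (stackD k *m diag sigma)^T =
    stackD k *m Sigma sigma *m (stackD k)^T.
  rewrite trmx_mul diag_tr !mulmxA; congr (_ *m _).
  by rewrite -mulmxA diag_mul.
rewrite /bigSigma /bigD /J_tensor_Sigma tr_mxblock !mul_mxblock.
rewrite /stackD mxcol_mul tr_mxcol mul_mxcol_mxrow.
apply: eq_mxblock => i j.
have -> : \sum_(a < k) (if i == a then D i.+1 else 0) *m Sigma sigma =
    D i.+1 *m Sigma sigma.
  rewrite (bigD1 i)//= eqxx big1 ?addr0// => l li.
  by rewrite eq_sym (negbTE li) mul0mx.
rewrite (bigD1 j)//= eqxx big1 ?addr0// => l lj.
by rewrite eq_sym (negbTE lj) trmx0 mulmx0.
Qed.

(** Blocks are indexed by natural numbers starting from 0, with the value 0 out of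
range, so that the scale indices of the procedure apply directly. *)
Definition blk k (u : 'cV[R]_(\sum_(i < k) p)) (j : nat) : 'cV[R]_p :=
  oapp (submxcol u) 0 (insub j).

Lemma blk_ord k u (i : 'I_k) : blk u i = submxcol u i.
Proof. by rewrite /blk valK. Qed.

Lemma blk_mxcol k (F : nat -> 'cV[R]_p) j : (j < k)%N ->
  blk (\mxcol_(i < k) F i) j = F j.
Proof.
by move=> jk; rewrite -[j]/(val (Ordinal jk)) blk_ord mxcolK.
Qed.

Lemma trmx_stackD k u : (stackD k)^T *m u = \sum_(i < k) (D i.+1)^T *m blk u i.
Proof.
rewrite /stackD tr_mxcol -[u in LHS]submxcolK mul_mxrow_mxcol.
by apply: eq_bigr => i _; rewrite blk_ord.
Qed.

(** A null vector of the transpose for k scales, padded with zero blocks, is one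
for K scales. *)
Lemma stackD_row_free k K : (k <= K)%N -> (forall i, sigma i != 0) ->
  pos_def (bigSigma sigma Psi w K) -> row_free (stackD k).
Proof.
move=> kK s0 [_ posK]; apply: row_free_trmx_inj => u Du.
pose u' := \mxcol_(i < K) blk u i.
have Du' : (stackD K)^T *m u' = 0.
  rewrite -Du !trmx_stackD.
  rewrite [RHS](big_ord_widen K (fun i => (D i.+1)^T *m blk u i))// [RHS]big_mkcond/=.
  apply: eq_bigr => i _; rewrite blk_mxcol//; case: ifPn => // ik.
  by rewrite /blk insubF ?mulmx0//; exact/negbTE.
have : ~ u' != 0.
  move=> /posK; rewrite bigSigmaE quad_gram_diag Du' big1 ?ltxx// => i _.
  by rewrite mxE expr0n mulr0.
move=> /negP/negPn/eqP u'0; apply/mxcolP => i; rewrite submxcol0 -blk_ord.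
rewrite -(blk_mxcol (blk u) (k := K)); last exact: leq_trans (ltn_ord i) kK.
by rewrite -/u' u'0 /blk; case: insubP => //= j _ _; rewrite submxcol0.
Qed.

End stacked_estimators.

(** * Transfer of moments and adaptive selection *)

Section gaussian_transfer.
Context {d : measure_display} {T : measurableType d} {R : realType}.
Variable P : probability T R.

Lemma gaussian_transfer m n (M : 'M[R]_(m, n)) (s s0 : 'I_n -> R)
    (delta a : R) (eps : 'I_n -> {RV P >-> R}) (h : 'cV[R]_m -> R)
    (b : 'cV[R]_m) :
  let Q := invmx (M *m diag s *m (M *m diag s)^T) in
  std_gaussian eps -> row_free M ->
  (forall i, 0 < s i) -> (forall i, 0 < s0 i) -> 0 <= delta < 1 ->
  (forall i, 1 - delta <= s0 i ^+ 2 / s i ^+ 2 <= 1 + delta) ->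
  0 < a -> (forall y, 0 <= h y) -> borel (fun y => (h y)%:E) ->
  (\int[P]_t (h (M *m diag s *m \col_i eps i t)%R ^+ 2)%:E <= a%:E)%E ->
  (\int[P]_t (h (M *m diag s0 *m (\col_i eps i t) + b)%R)%:E <=
   (a `^ (1 / 2) * ((1 + delta) `^ (m%:R / 4) *
     (1 - delta) `^ (- (3 * m%:R / 4)) *
     expR (quad Q b / (2 * (1 - delta)))))%:E)%E.
Proof.
move=> Q heps fM sp s0p d01 A3 a0 h0 mh ha.
have fS : row_free (M *m diag s) by apply: row_free_mul_diag => // i; rewrite gt_eqF.
have fS0 : row_free (M *m diag s0) by apply: row_free_mul_diag => // i; rewrite gt_eqF.
have [c [c_gt0 Qc law]] := std_gaussian_image_density heps fS.
have [c0 [c0_gt0 Qc0 law0]] := std_gaussian_image_density heps fS0.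
have cmp := quad_gram_inv_comparison fM sp s0p d01 A3.
rewrite (law0 (fun y => (h (y + b))%:E)); last 2 first.
- by move=> y; rewrite lee_fin.
- exact: (borel_translate b mh).
apply: (change_of_measure b _ d01 a0 c_gt0 c0_gt0 _ _ Qc Qc0 h0 mh).
- by rewrite trmx_inv gram_tr.
- by move=> y; have /andP[] := cmp y.
- by move=> y; have /andP[] := cmp y.
rewrite -(law (fun y => (h y ^+ 2)%:E))//.
  by move=> y; rewrite lee_fin sqr_ge0.
move=> d' T' f mf; apply/measurable_EFinP; apply: measurable_funX.
by apply/measurable_EFinP; exact: mh.
Qed.

End gaussian_transfer.

Section selection.
Context {R : realType} {p : nat}.
Variables (B : nat -> 'M[R]_p) (z : nat -> R).
Implicit Types t : nat -> 'cV[R]_p.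

(** The selection rule as a function of the sequence of estimators, whatever
produces them: it is applied both to the estimators and to the blocks of the
stacked vector. *)
Definition acceptable t (k : nat) : bool :=
  [forall l : 'I_k.+1, forall m : 'I_k.+1,
    (1 <= l < m)%N ==> (quad (B l) (t l - t m) <= z l)].

Definition selected (k : nat) t : nat := \max_(j < k.+1 | acceptable t j) j.

Lemma acceptableP t k :
  reflect (forall l m, (1 <= l < m)%N -> (m <= k)%N -> quad (B l) (t l - t m) <= z l)
          (acceptable t k).
Proof.
apply: (iffP forallP) => [H l m lm mk|H l].
  have lk : (l < k.+1)%N by case/andP: lm => _ lm'; exact: leq_trans lm' (leqW mk).
  have mk1 : (m < k.+1)%N by [].
  by have /forallP/(_ (Ordinal mk1))/implyP := H (Ordinal lk); exact.
apply/forallP => m; apply/implyP => lm; apply: H => //.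
by rewrite -ltnS.
Qed.

Lemma acceptable_le t j k : (j <= k)%N -> acceptable t k -> acceptable t j.
Proof.
move=> jk /acceptableP H; apply/acceptableP => l m lm mj; apply: H => //.
exact: leq_trans mj jk.
Qed.

Lemma acceptable1 t j : (j <= 1)%N -> acceptable t j.
Proof.
move=> j1; apply/acceptableP => l m /andP[l1 lm] mj.
by have := leq_ltn_trans l1 (leq_trans lm (leq_trans mj j1)); rewrite ltnn.
Qed.

Lemma selectedP k t : [/\ acceptable t (selected k t), (selected k t <= k)%N &
  forall j, (j <= k)%N -> acceptable t j -> (j <= selected k t)%N].
Proof.
have A0 : acceptable t (ord0 : 'I_k.+1) by exact: acceptable1.
have [j Aj Ej] : {j : 'I_k.+1 | acceptable t j & selected k t = j}.
  by apply: (eq_bigmax_cond (fun j : 'I_k.+1 => j : nat)); apply/card_gt0P; exists ord0.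
rewrite Ej; split => //; first by rewrite -ltnS.
move=> i ik Ai; rewrite -Ej -[i]/(val (Ordinal (ik : (i < k.+1)%N))).
exact: (leq_bigmax_cond (F := fun j : 'I_k.+1 => j : nat)).
Qed.

(** Acceptability is inherited by smaller indices, so truncating at k the index
selected among K scales amounts to selecting among k scales. *)
Lemma minn_selected k K t : (k <= K)%N -> minn k (selected K t) = selected k t.
Proof.
move=> kK; have [AK lK mK] := selectedP K t; have [Ak lk mk] := selectedP k t.
apply/eqP; rewrite eqn_leq; apply/andP; split.
  by apply: mk; [exact: geq_minl|apply: acceptable_le AK; exact: geq_minr].
by rewrite leq_min lk; apply: mK => //; exact: leq_trans lk kK.
Qed.

Lemma selected_gt0 k t : (0 < k)%N -> (0 < selected k t)%N.
Proof. by move=> k0; have [_ _ mk] := selectedP k t; apply: mk => //; exact: acceptable1. Qed.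

Lemma eq_selected k t t' :
  (forall l m, (1 <= l < m)%N -> (m <= k)%N -> t l - t m = t' l - t' m) ->
  selected k t = selected k t'.
Proof.
move=> tt'; apply: eq_bigl => j; apply/acceptableP/acceptableP => H l m lm mj.
  by rewrite -tt' ?H//; apply: leq_trans mj _; rewrite -ltnS.
by rewrite tt' ?H//; apply: leq_trans mj _; rewrite -ltnS.
Qed.

Lemma measurable_forall d (T : measurableType d) (I : finType) (b : I -> T -> bool) :
  (forall i, measurable_fun [set: T] (b i)) ->
  measurable_fun [set: T] (fun x => [forall i, b i x]).
Proof.
move=> mb.
rewrite (_ : (fun x => _) = (fun x => \big[andb/true]_i b i x)); last first.
  by apply/funext => x; rewrite big_andE.
elim: (index_enum I) => [|i s IH].
  by under eq_fun do rewrite big_nil; exact: measurable_cst.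
by under eq_fun do rewrite big_cons; apply: measurable_and.
Qed.

Lemma measurable_selected d (T : measurableType d) (t : T -> nat -> 'cV[R]_p) k :
  (forall j, coord_measurable (fun x => t x j)) ->
  measurable_fun [set: T] (fun x => selected k (t x)).
Proof.
move=> mt; have macc j : measurable_fun [set: T] (fun x => acceptable (t x) j).
  apply: measurable_forall => l; apply: measurable_forall => m.
  case: (1 <= l < m)%N => /=; last exact: measurable_cst.
  apply: measurable_fun_ler => //; apply: measurable_quad => i.
  under eq_fun do rewrite !mxE.
  by apply: measurable_funB; exact: mt.
rewrite /selected; elim: k.+1 => [|N IH].
  by under eq_fun do rewrite big_ord0; exact: measurable_cst.
under eq_fun do rewrite big_mkcond big_ord_recr/= -big_mkcond.
apply: measurable_fun_maxn; first exact: IH.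
exact: measurable_fun_ifT.
Qed.

(** The loss at a selected index is a finite sum of losses at fixed indices, each
restricted to the event that this index is selected. *)
Lemma borel_selected_loss k m (t : 'cV[R]_m -> nat -> 'cV[R]_p)
    (loss : 'cV[R]_m -> nat -> R) :
  (forall d (T : measurableType d) (f : T -> 'cV[R]_m) j,
     coord_measurable f -> coord_measurable (fun x => t (f x) j)) ->
  (forall j, borel (fun y => (loss y j)%:E)) ->
  borel (fun y => (loss y (selected k (t y)))%:E).
Proof.
move=> mt ml d T f mf; apply/measurable_EFinP.
have -> : (fun x => loss (f x) (selected k (t (f x)))) =
  (fun x => \sum_(j < k.+1) if selected k (t (f x)) == j then loss (f x) j else 0).
  apply/funext => x; have [_ sk _] := selectedP k (t (f x)).
  rewrite (bigD1 (Ordinal (sk : (selected k (t (f x)) < k.+1)%N)))//= eqxx big1 ?addr0// => j jN.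
  by case: eqP => // E; case/eqP: jN; apply: val_inj.
have ms : measurable_fun [set: T] (fun x => selected k (t (f x))).
  by apply: measurable_selected => j; exact: mt.
apply: measurable_sum => j; apply: measurable_fun_ifT => //.
  exact: (measurable_fun_eqn ms (measurable_cst (j : nat))).
by apply/measurable_EFinP; exact: ml.
Qed.

End selection.

(** * The bounds for the quasi-MLE and the adaptive estimator *)

Section quasi_mle_moment.
Context {d : measure_display} {T : measurableType d} {R : realType}.
Variable P : probability T R.

(** B_k is at most the precision matrix of the quasi-MLE, whose quadratic form has
exactly the chi-squared moments. *)
Lemma qmle_moment n p (sigma : 'I_n -> R) (Psi : 'M[R]_(p, n))
    (w : nat -> 'I_n -> R) (k : nat) (eps : 'I_n -> {RV P >-> R}) (r : R) :
  (0 < p)%N -> (forall i, 0 < sigma i) ->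
  (forall i, 0 <= w 1%N i) -> (forall i, w 1%N i <= w k i) ->
  (forall i, w k i <= 1) -> row_free (Psi *m diag (w 1%N)) ->
  std_gaussian eps -> 0 < r ->
  0 < C p r /\
  (\int[P]_t (`|quad (B sigma Psi w k)
     (D sigma Psi w k *m diag sigma *m (\col_i eps i t))%R| `^ r)%:E <=
   (C p r)%:E)%E.
Proof.
move=> p0 sp w1_0 w1_le w_le1 rk heps r0.
set M := D sigma Psi w k *m diag sigma.
have fM : row_free M.
  apply: row_free_mul_diag; first by move=> i; rewrite gt_eqF.
  exact: (D_row_free sp w1_0 w1_le rk).
have [c [c0 Qc law]] := std_gaussian_image_density heps fM.
have Q0 y := quad_gram_inv_ge0 y fM.
have [C0 CE] := chi_square_moment Q0 p0 c0 Qc r0.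
split => //; rewrite -CE.
have mB m (A : 'M[R]_m) : borel (fun y => (`|quad A y| `^ r)%:E).
  move=> d' T' f mf; apply/measurable_EFinP.
  apply: (measurableT_comp (measurable_powR _)).
  by apply: measurableT_comp => //; exact: measurable_quad.
rewrite (law (fun y => (`|quad (B sigma Psi w k) y| `^ r)%:E))//.
apply: lee_wpmul2l; first by rewrite lee_fin ltW.
apply: le_lebint.
- by move=> y; rewrite -EFinM lee_fin mulr_ge0 ?powR_ge0 ?expR_ge0.
- by apply: borelM => //; exact: borel_expR_quad.
- apply: borelM; last exact: borel_expR_quad.
  rewrite (_ : (fun y => _) = (fun y => (`|quad (invmx (M *m M^T)) y| `^ r)%:E))//.
  by apply/funext => y; rewrite ger0_norm.
move=> y; rewrite -!EFinM lee_fin ler_wpM2r ?expR_ge0//.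
have qB : 0 <= quad (B sigma Psi w k) y by exact: (quad_B_ge0 _ sp w1_0 w1_le).
rewrite ger0_norm//; apply: ge0_ler_powR; rewrite ?nnegrE//; first exact: ltW.
exact: (quad_B_le_precision sp w1_0 w1_le w_le1 rk).
Qed.

End quasi_mle_moment.

Section reduction.
Context {R : realType} {n p : nat}.
Variables (sigma : 'I_n -> R) (Psi : 'M[R]_(p, n)) (w : nat -> 'I_n -> R).
Local Notation qmle := (qmle sigma Psi w).
Local Notation B := (B sigma Psi w).

Lemma theta_hatE K z k Y : (k <= K)%N ->
  theta_hat sigma Psi w K z k Y = qmle (selected B z k (qmle^~ Y)) Y.
Proof.
by move=> kK; rewrite -(minn_selected _ _ _ kK).
Qed.

Lemma blk_stackD k (s : 'I_n -> R) (f e : 'cV[R]_n) (theta : 'cV[R]_p) j :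
  (0 < j <= k)%N ->
  blk (stackD sigma Psi w k *m diag s *m e + bias sigma Psi w f theta k) j.-1 =
  qmle j (f + diag s *m e) - theta.
Proof.
case: j => [//|j] /= jk.
have -> : stackD sigma Psi w k *m diag s *m e + bias sigma Psi w f theta k =
    \mxcol_(i < k) (qmle i.+1 (f + diag s *m e) - theta).
  rewrite /stackD !mxcol_mul /bias -mxcolD; apply: eq_mxcol => i.
  by rewrite /Defs.qmle mulmxDr !mulmxA addrCA addrA.
by rewrite (blk_mxcol (fun i => qmle i.+1 _ - theta)).
Qed.

(** Centring the estimators at theta changes neither their differences nor the
selected index. *)
Lemma selected_difference (K k : nat) (z : nat -> R) (t : nat -> 'cV[R]_p)
    (Y : 'cV[R]_n) (theta : 'cV[R]_p) :
  (0 < k)%N -> (k <= K)%N ->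
  (forall j, (0 < j <= k)%N -> t j = qmle j Y - theta) ->
  t k - t (selected B z k t) = qmle k Y - theta_hat sigma Psi w K z k Y.
Proof.
move=> k0 kK tE.
have diffE l m : (0 < l <= k)%N -> (0 < m <= k)%N ->
    t l - t m = qmle l Y - qmle m Y.
  by move=> lk mk; rewrite (tE _ lk) (tE _ mk) opprB addrA subrK.
have -> : selected B z k t = selected B z k (qmle^~ Y).
  apply: eq_selected => l m /andP[l1 lm] mk; apply: diffE.
    by rewrite l1 (leq_trans (ltnW lm)).
  by rewrite mk (leq_ltn_trans _ lm).
have [_ sk _] := selectedP B z k (qmle^~ Y).
have s0 := selected_gt0 B z (qmle^~ Y) k0.
rewrite (theta_hatE _ _ kK); apply: diffE; first by rewrite k0 leqnn.
by rewrite s0.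
Qed.

End reduction.

Lemma phi_ge1 (R : realType) n (sigma0 sigma : 'I_n -> R) (delta : R) :
  0 <= delta < 1 -> 1 <= phi sigma0 sigma delta.
Proof.
move=> /andP[d0 d1]; rewrite /phi; case: ifP => // _.
have m0 : 0 < (1 - delta) ^+ 2 by rewrite exprn_gt0// subr_gt0.
rewrite lerBrDr ler_pdivlMr//; nra.
Qed.

Theorem theorem3p2
  (R : realType) (d n p K : nat) (hp : (0 < p)%N) (hnp : (p < n)%N)
  (x : 'cV[R]_d) (X : 'I_n -> 'cV[R]_d) (psi : 'I_p -> 'cV[R]_d -> R)
  (f : 'cV[R]_d -> R)
  (sigma0 sigma : 'I_n -> R)
  (hsigma0 : forall i, 0 < sigma0 i) (hsigma : forall i, 0 < sigma i)
  (w : nat -> 'I_n -> R)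
  (hw : forall k i, (1 <= k <= K)%N -> 0 <= w k i <= 1)
  (disp : measure_display) (T : measurableType disp) (P : probability T R)
  (eps : 'I_n -> {RV P >-> R}) (heps : std_gaussian eps)
  (z : nat -> R) (hz : forall l, (1 <= l < K)%N -> 0 < z l)
  (delta u0 u alpha r : R) (theta : 'cV[R]_p) :
  let Psi := design psi X x in
  let fX := \col_i f (X i) in
  let B := B sigma Psi w in
  let qmle := qmle sigma Psi w in
  let theta_hat := theta_hat sigma Psi w K z in
  let Delta := Delta sigma Psi w fX theta in
  let Y := observation fX sigma0 eps in
  forall
  (A1 : row_free (Psi *m diag (w 1%N)))
  (A2 : forall l k i, (1 <= l <= k)%N -> (k <= K)%N -> w l i <= w k i)
  (A3_range : 0 <= delta < 1)
  (A3 : forall i, 1 - delta <= sigma0 i ^+ 2 / sigma i ^+ 2 <= 1 + delta)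
  (A4_range : 1 < u0 <= u)
  (A4 : forall k, (2 <= k <= K)%N ->
     let S := invsqrt (B k.-1) in
     loewner_le u0%:M (S *m B k *m S) /\ loewner_le (S *m B k *m S) u%:M)
  (hSigmaK : pos_def (bigSigma sigma Psi w K))
  (halpha : 0 < alpha <= 1) (hr : 0 < r)
  (PC : propagation sigma Psi w eps K z alpha r)
  (k : nat) (hk : (1 <= k <= K)%N),
  let bound := (1 + delta) `^ ((p * k)%:R / 4) *
               (1 - delta) `^ (- (3 * (p * k)%:R / 4)) *
               expR (phi sigma0 sigma delta *
                     (Delta k / (2 * (1 - delta)))) in
  ('E_P[fun omega => (`|quad (B k) (qmle k (Y omega) - theta)| `^ (r / 2))%R]
     <= (C p r `^ (1 / 2) * bound)%R%:E)%E
  /\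
  ('E_P[fun omega =>
      (`|quad (B k) (qmle k (Y omega) - theta_hat k (Y omega))| `^ (r / 2))%R]
     <= ((alpha * C p r) `^ (1 / 2) * bound)%R%:E)%E.
Proof.
move=> Psi fX B qmle theta_hat Delta Y A1 A2 d01 A3 u01 A4 posK /andP[al0 al1] r0 PC
  k /andP[k1 kK] bound.
have K1 : (1 <= K)%N by exact: leq_trans kK.
have w1_0 i : 0 <= w 1%N i by have := hw 1%N i; rewrite /= K1 => /(_ isT)/andP[].
have w1_le i : w 1%N i <= w k i by apply: A2; rewrite ?k1.
have w_le1 i : w k i <= 1 by have := hw k i; rewrite k1 kK => /(_ isT)/andP[].
have [C0 CE] := qmle_moment hp hsigma w1_0 w1_le w_le1 A1 heps r0.
have fD : row_free (stackD sigma Psi w k).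
  by apply: stackD_row_free kK _ posK => i; rewrite gt_eqF.
pose b := bias sigma Psi w fX theta k.
have main h a : 0 < a -> (forall y, 0 <= h y) -> borel (fun y => (h y)%:E) ->
  (\int[P]_t (h (stackD sigma Psi w k *m diag sigma *m \col_i eps i t)%R ^+ 2)%:E
     <= a%:E)%E ->
  (\int[P]_t (h (stackD sigma Psi w k *m diag sigma0 *m (\col_i eps i t) + b)%R)%:E
     <= (a `^ (1 / 2) * bound)%:E)%E.
  move=> a0 h0 mh ha.
  apply: le_trans (gaussian_transfer b heps fD hsigma hsigma0 d01 A3 a0 h0 mh ha) _.
  have pkE : (\sum_(i < k) p)%N%:R = (p * k)%:R :> R.
    by rewrite sum_nat_const card_ord mulnC.
  rewrite lee_fin ler_wpM2l ?powR_ge0// /bound pkE.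
  rewrite ler_wpM2l ?mulr_ge0 ?powR_ge0// ler_expR.
  rewrite /Delta /Defs.Delta bigSigmaE -/b.
  have /andP[_ d1] := d01.
  rewrite ler_peMl ?(phi_ge1 _ _ d01)// divr_ge0 ?mulr_ge0 ?subr_ge0 ?(ltW d1)//.
  by apply: quad_gram_inv_ge0; apply: row_free_mul_diag fD => i; rewrite gt_eqF.
pose t (v : 'cV[R]_(\sum_(i < k) p)) j := blk v j.-1.
have mt d' (T' : measurableType d') (g : T' -> 'cV[R]_(\sum_(i < k) p)) j :
    coord_measurable g -> coord_measurable (fun x => t (g x) j).
  move=> mg i; rewrite /t /blk; case: insub => [l|] /=; last first.
    by under eq_fun do rewrite mxE; exact: measurable_cst.
  by under eq_fun do rewrite mxE; exact: mg.
have powR_sqr (y : R) : (y `^ (r / 2)) ^+ 2 = y `^ r.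
  by rewrite -powR_mulrn ?powR_ge0// -powRrM divfK.
(* under Sigma and with a zero regression vector the blocks are the estimators of
   the propagation condition *)
have tY0 e j : (0 < j <= k)%N ->
    t (stackD sigma Psi w k *m diag sigma *m e) j = qmle j (0 + diag sigma *m e) - 0.
  move=> jk; rewrite -(blk_stackD sigma Psi w sigma 0 e 0 jk).
  suff -> : bias sigma Psi w 0 0 k = 0 by rewrite addr0.
  rewrite /bias; under eq_mxcol do rewrite /Defs.qmle mulmx0 subr0.
  exact: mxcol0.
have mloss (g : 'cV[R]_(\sum_(i < k) p) -> 'cV[R]_p) :
    (forall d' (T' : measurableType d') (f' : T' -> _), coord_measurable f' ->
       coord_measurable (fun x => g (f' x))) ->
    borel (fun v => (`|quad (B k) (g v)| `^ (r / 2))%:E).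
  move=> mg d' T' f' mf; apply/measurable_EFinP.
  apply: (measurableT_comp (measurable_powR _)).
  by apply: measurableT_comp => //; apply: measurable_quad; exact: mg.
split; rewrite expectation.unlock.
  pose h v := `|quad (B k) (t v k)| `^ (r / 2).
  apply: le_trans (main h (C p r) C0 _ _ _).
  - rewrite le_eqVlt; apply/orP; left; apply/eqP; apply: eq_integral => o _.
    by rewrite /h /t blk_stackD// k1 leqnn.
  - by move=> y; exact: powR_ge0.
  - by apply: mloss => d' T' f' mf; exact: mt.
  apply: le_trans CE; rewrite le_eqVlt; apply/orP; left; apply/eqP.
  apply: eq_integral => o _; rewrite /h powR_sqr tY0 ?k1 ?leqnn// subr0 add0r.
  by rewrite /qmle /Defs.qmle mulmxA.
pose sel v := selected B z k (t v).
pose h v := `|quad (B k) (t v k - t v (sel v))| `^ (r / 2).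
have hE v Y' theta' : (forall j, (0 < j <= k)%N -> t v j = qmle j Y' - theta') ->
    h v = `|quad (B k) (qmle k Y' - theta_hat k Y')| `^ (r / 2).
  by move=> tE; rewrite /h /sel (selected_difference z k1 kK tE).
have aC0 : 0 < alpha * C p r by rewrite mulr_gt0.
apply: le_trans (main h (alpha * C p r) aC0 _ _ _).
- rewrite le_eqVlt; apply/orP; left; apply/eqP; apply: eq_integral => o _.
  by rewrite (hE _ (Y o) theta)// => j jk; rewrite /t blk_stackD.
- by move=> y; exact: powR_ge0.
- apply: (@borel_selected_loss _ _ B z k _ t
    (fun v j => `|quad (B k) (t v k - t v j)| `^ (r / 2))) => //.
  move=> j; apply: mloss => d' T' f' mf i.
  under eq_fun do rewrite mxE [X in _ + X]mxE.
  by apply: measurable_funB; exact: mt.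
have [k2|k2] := leqP 2 k.
  have := PC k; rewrite k2 kK => /(_ isT); apply: le_trans.
  rewrite expectation.unlock le_eqVlt; apply/orP; left; apply/eqP.
  apply: eq_integral => o _.
  by rewrite (hE _ (observation 0 sigma eps o) 0) ?powR_sqr// => j jk; exact: tY0.
(* at the first scale the adaptive estimator is the quasi-MLE *)
have kE : k = 1%N by apply/eqP; rewrite eqn_leq k1 andbT -ltnS.
rewrite integral0_eq ?lee_fin ?ltW// => o _.
rewrite /h /sel.
have -> v : selected B z k (t v) = k.
  apply/eqP; rewrite eqn_leq; have [_ -> _] := selectedP B z k (t v).
  by rewrite {1}kE selected_gt0.
rewrite subrr powR_sqr.
have -> : quad (B k) 0 = 0 by rewrite /quad mulmx0 mxE.
by rewrite normr0 powR0// gt_eqF.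
Qed.
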